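(* Let $M$ be a matroid of rank $r$ on $[n]$. The Bergman fan $\widetilde{\mathcal B}(M)$ is a union of cones of the normal fan of $P_M$; precisely, it is the union of those cones $\Gamma$ of the normal fan for which the matroid $M_\Gamma$ has no loop. If $M$ is connected, then the rays (one-dimensional cones modulo the line $\mathbb R(1,\dots,1)$) of this subfan are exactly $\mathbb R_{\ge 0}e_F+\mathbb R(1,\dots,1)$ for $F$ ranging over the flacets of $M$. Furthermore, the Bergman complex $\mathcal B(M)$ is homotopy equivalent to $\partial P_M\setminus\partial\Delta$, where $\partial P_M$ is the relative boundary of $P_M$ and $\partial\Delta$ the relative boundary of $\Delta=\{x\in\mathbb R^n_{\ge0}:\sum x_i=r\}$.
   Context: A matroid $M$ of rank $r$ on $[n]$ is specified by its set of bases; $e_\sigma=\sum_{i\in\sigma}e_i$ and $P_M=\operatorname{conv}\{e_\sigma\}$. For $w\in\mathbb R^n$, $M_w$ is the matroid whose bases are the bases of $M$ of maximal $w$-weight $\sum_{i\in\sigma}w_i$. Two vectors $w,w'$ are equivalent if $M_w=M_{w'}$; the closures of the equivalence classes are the cones of the (outer) normal fan of $P_M$, and for a cone $\Gamma$ one writes $M_\Gamma=M_w$ for $w$ in its relative interior. The Bergman fan $\widetilde{\mathcal B}(M)$ is the set of $w\in\mathbb R^n$ such that for every circuit $C$ the minimum of $\{w_i:i\in C\}$ is attained at least twice. The Bergman complex is $\mathcal B(M)=\widetilde{\mathcal B}(M)\cap\mathbb S$ with $\mathbb S=\{w:\sum w_i=0,\ \sum w_i^2=1\}$. $e_F$ denotes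 the incidence vector of $F\subseteq[n]$. For connected $M$, a flacet is a flat $F$ such that $\{x\in P_M:\sum_{i\in F}x_i=\operatorname{rank}(F)\}$ is a facet of $P_M$.
   Formalization: The homotopy equivalence of the Bergman complex with ∂P_M∖∂Δ is proved for connected M only; it fails for loopless disconnected M (two coloops: two points versus the empty set), and for disconnected M with a loop both sides are empty. *)

(* Defs.v *)
From HB Require Import structures.
From mathcomp Require Import all_boot all_order all_algebra.
From mathcomp Require Import all_classical all_reals all_analysis.
Set Implicit Arguments. Unset Strict Implicit. Unset Printing Implicit Defensive.
Import Order.TTheory GRing.Theory Num.Theory.
Import numFieldNormedType.Exports.
Local Open Scope classical_set_scope.
Local Open Scope ring_scope.

Section Matroids.
Variables (R : realType) (n : nat).
Notation V := 'rV[R]_n.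

Definition is_matroid (B : {set {set 'I_n}}) : Prop :=
  B != finset.set0 /\
  forall B1 B2, B1 \in B -> B2 \in B -> forall x, x \in B1 :\: B2 ->
    exists2 y, y \in B2 :\: B1 & (y |: (B1 :\ x)) \in B.

Definition has_rank (B : {set {set 'I_n}}) (r : nat) : Prop :=
  forall s, s \in B -> #|s| = r.

Definition indep (B : {set {set 'I_n}}) (I : {set 'I_n}) : Prop :=
  exists2 s, s \in B & I \subset s.

Definition circuit (B : {set {set 'I_n}}) (C : {set 'I_n}) : Prop :=
  ~ indep B C /\ forall D : {set 'I_n}, D \proper C -> indep B D.

Definition rankf (B : {set {set 'I_n}}) (F : {set 'I_n}) : nat :=
  \max_(s in B) #|F :&: s|.

Definition flat (B : {set {set 'I_n}}) (F : {set 'I_n}) : Prop :=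
  forall i, i \notin F -> (rankf B F < rankf B (i |: F))%N.

Definition loopless (B : {set {set 'I_n}}) : Prop :=
  forall i, exists2 s, s \in B & i \in s.

Definition connected_matroid (B : {set {set 'I_n}}) : Prop :=
  forall i j, i != j -> exists C, [/\ circuit B C, i \in C & j \in C].

Definition incid (F : {set 'I_n}) : V := \row_i (i \in F)%:R.
Definition ones : V := \row_i 1.

Definition weight (w : V) (s : {set 'I_n}) : R := \sum_(i in s) w ord0 i.

Definition Mw (B : {set {set 'I_n}}) (w : V) : {set {set 'I_n}} :=
  [set s in B | [forall t in B, weight w t <= weight w s]].

Definition polytope (B : {set {set 'I_n}}) : set V :=
  [set x | exists l : {set 'I_n} -> R, [/\ (forall s, 0 <= l s),
       \sum_(s in B) l s = 1 & x = \sum_(s in B) l s *: incid s]].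

Definition face_of (B : {set {set 'I_n}}) (F : {set 'I_n}) : set V :=
  [set x | polytope B x /\ \sum_(i in F) x ord0 i = (rankf B F)%:R].

Definition aff_indep k (p : 'I_k.+1 -> V) : bool :=
  row_free (\matrix_(i < k) (p (lift ord0 i) - p ord0)).

Definition has_affdim (S : set V) (d : nat) : Prop :=
  (exists p : 'I_d.+1 -> V, (forall i, S (p i)) /\ aff_indep p) /\
  ~ (exists p : 'I_d.+2 -> V, (forall i, S (p i)) /\ aff_indep p).

Definition facet_of (B : {set {set 'I_n}}) (F : {set 'I_n}) : Prop :=
  exists d, has_affdim (polytope B) d.+1 /\ has_affdim (face_of B F) d.

Definition flacet (B : {set {set 'I_n}}) (F : {set 'I_n}) : Prop :=
  flat B F /\ facet_of B F.

Definition bergman_fan (B : {set {set 'I_n}}) : set V :=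
  [set w | forall C, circuit B C -> exists i j,
     [/\ i \in C, j \in C, i != j, w ord0 i = w ord0 j &
         forall k, k \in C -> w ord0 i <= w ord0 k]].

Definition sphere : set V :=
  [set w | \sum_i w ord0 i = 0 /\ \sum_i (w ord0 i) ^+ 2 = 1].

Definition bergman_complex (B : {set {set 'I_n}}) : set V :=
  bergman_fan B `&` sphere.

(* the cone of the normal fan whose relative interior contains w *)
Definition fan_cone (B : {set {set 'I_n}}) (w : V) : set V :=
  closure [set w' | Mw B w' = Mw B w].

Definition ray_of (F : {set 'I_n}) : set V :=
  [set w | exists a t : R, 0 <= a /\ w = a *: incid F + t *: ones].

Definition affhull (S : set V) : set V :=
  [set x | exists k (p : 'I_k -> V) (l : 'I_k -> R),
     [/\ (forall i, S (p i)), \sum_i l i = 1 & x = \sum_i l i *: p i]].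

Definition relint (S : set V) : set V :=
  [set x | S x /\ exists2 e : R, 0 < e &
     forall y, affhull S y -> ball x e y -> S y].

Definition relbd (S : set V) : set V := closure S `\` relint S.

Definition simplex (r : nat) : set V :=
  [set x | (forall i, 0 <= x ord0 i) /\ \sum_i x ord0 i = r%:R].

Definition homotopic_to_id (A : set V) (h : V -> V) : Prop :=
  exists H : R * V -> V,
    [/\ ({within [set p : R * V | 0 <= p.1 <= 1 /\ A p.2], continuous H}),
        (forall p : R * V, 0 <= p.1 <= 1 -> A p.2 -> A (H p)),
        (forall x, A x -> H (0, x) = h x) &
        (forall x, A x -> H (1, x) = x)].

Definition homotopy_equiv (A C : set V) : Prop :=
  exists f g : V -> V,
    [/\ (forall x, A x -> C (f x)), (forall y, C y -> A (g y)),
        {within A, continuous f}, {within C, continuous g} &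
        homotopic_to_id A (g \o f) /\ homotopic_to_id C (f \o g)].

End Matroids.

(* Main.v *)
(* By exchange, a basis of maximal [w]-weight is tight for every superlevel set
   of [w], so a loop of [M_w] is the unique [w]-minimal element of a circuit;
   this gives the first claim.
   By Abel summation along superlevel sets the base polytope is
   {x | sum x = r, x(F) <= rank F for all F}, so its proper faces off the
   coordinate hyperplanes are cut out by flats, and the dimension of a face is
   complementary to that of its normal cone.

   For the homotopy equivalence, [w] is sent to an average of the vertices e_s
   whose [w]-weight is within a constant of the maximum, weighted continuously:
   since some superlevel set F of [w] has a large gap, all these bases are
   tight for F, and the bases of the loopless [M_w] occur, so the average is a
   boundary point with positive coordinates. Conversely [x] is sent to
   sum_F max(0, eps(x) - slack_F(x)) e_F, normalised, where
   slack_F(x) = rank F - x(F) and eps(x) is small compared to min x_i.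
   Averaging the slacks over a convex decomposition of [x] shows that each
   element lies in a basis tight for all the F involved, so the image lies in
   the Bergman fan. Both composites are joined to the identity by (normalised)
   segments, which stay in the normal cone of a common face, resp. in a common
   facet. *)
Require Import Defs.
From HB Require Import structures.
From mathcomp Require Import all_boot all_order all_algebra.
From mathcomp Require Import all_classical all_reals all_analysis.
From mathcomp Require Import zify ring lra.
Set Implicit Arguments. Unset Strict Implicit. Unset Printing Implicit Defensive.
Import Order.TTheory GRing.Theory Num.Theory.
Import numFieldNormedType.Exports.
Local Open Scope classical_set_scope.
Local Open Scope ring_scope.

(** * Basis exchange, tight bases and circuits *)

Section MatroidCombinatorics.
Variables (n r : nat) (B : {set {set 'I_n}}).
Hypotheses (mB : is_matroid B) (rB : has_rank B r).
Implicit Types F I s t : {set 'I_n}.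

Lemma rankf_ge F s : s \in B -> (#|F :&: s| <= rankf B F)%N.
Proof. by move=> sB; apply: (leq_bigmax_cond (F := fun s => #|F :&: s|)). Qed.

Lemma exists_basis : exists s, s \in B.
Proof. by case: mB => /set0Pn. Qed.

Lemma rankf_attained F : exists2 s, s \in B & #|F :&: s| = rankf B F.
Proof.
have [s0 s0B] := exists_basis.
have : (0 < #|B|)%N by apply/card_gt0P; exists s0.
case/(eq_bigmax_cond (fun s => #|F :&: s|)) => s sB E.
by exists s => //; rewrite /rankf E.
Qed.

Lemma card_swap s x y : x \in s -> y \notin s -> #|y |: (s :\ x)| = #|s|.
Proof.
move=> xs ys; rewrite cardsU1 !inE (negPf ys) andbF (cardsD1 x s) xs.
by rewrite add1n.
Qed.

Lemma card_setI_ltP F s t : s \in B -> t \in B ->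
  (#|F :&: s| < #|F :&: t|)%N -> (#|t :\: F| < #|s :\: F|)%N.
Proof.
move=> sB tB ltF; have cs := cardsID F s; have ct := cardsID F t.
rewrite (rB sB) in cs; rewrite (rB tB) in ct.
rewrite ![_ :&: F]finset.setIC in cs ct; lia.
Qed.

Lemma exchange_into F s : s \in B -> (#|F :&: s| < rankf B F)%N ->
  exists x y, [/\ y \in F, y \notin s, x \in s, x \notin F
                & y |: (s :\ x) \in B].
Proof.
move=> sB ltF; have [t tB tF] := rankf_attained F.
case: mB => _ exB.
(* Among the bases tight on [F], take one with largest intersection with [s]:
   its part outside [F] then lies in [s]. *)
pose P := fun t => (t \in B) && (#|F :&: t| == rankf B F).
have Pt : P t by rewrite /P tB tF eqxx.
case: (arg_maxnP (fun t => #|t :&: s|) Pt) => t1 /andP[t1B /eqP t1F] tmax.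
have sub z : z \in t1 -> z \notin F -> z \in s.
  move=> zt zF; apply: contraT => zs.
  have [|y] := exB _ _ t1B sB z; first by rewrite !inE zs.
  rewrite !inE => /andP[yt ys] t2B.
  have /tmax : P (y |: (t1 :\ z)).
    rewrite /P t2B eqn_leq rankf_ge //= -t1F; apply/subset_leq_card.
    apply/fintype.subsetP => k; rewrite !inE => /andP[kF kt]; rewrite kF kt.
    by rewrite andbT orbC; case: eqVneq => // kz; rewrite -kz kF in zF.
  rewrite /= leqNgt => /negP[]; apply: proper_card; apply/properP; split.
    apply/fintype.subsetP => k; rewrite !inE => /andP[kt ks]; rewrite kt ks.
    by rewrite !andbT orbC; case: eqVneq => // kz; rewrite -kz ks in zs.
  by exists y; rewrite !inE ?eqxx ?ys // (negPf yt).
(* Since [t1] meets [F] in more elements than [s], some [x] of [s] outside [F] is missing from [t1].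
   The element exchanged for it lies in [t1] but not in [s], hence in [F] by [sub]. *)
have [x] : exists x, x \in (s :\: F) :\: (t1 :\: F).
  apply/set0Pn; rewrite finset.setD_eq0; apply: contraL ltF => /subset_leq_card le.
  rewrite -t1F; apply/negP => /(card_setI_ltP sB t1B); lia.
rewrite !inE => /andP[xt /andP[xF xs]]; rewrite xF /= in xt.
have [|y] := exB _ _ sB t1B x; first by rewrite !inE xs xt.
rewrite !inE => /andP[ys yt] s2B; exists x, y; split=> //.
by apply: contraR ys; exact: sub.
Qed.

(** Among the bases containing [I], one with largest intersection with [F] is tight: an exchange
    into [F] only discards an element outside [F], so it keeps [I]. *)
Lemma extend_tight I F t : t \in B -> I \subset t -> I \subset F ->
  exists t', [/\ t' \in B, I \subset t' & #|F :&: t'| = rankf B F].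
Proof.
move=> tB It IF.
pose P := fun t => (t \in B) && (I \subset t).
have Pt : P t by rewrite /P tB It.
case: (arg_maxnP (fun t => #|F :&: t|) Pt) => t1 /andP[t1B It1] tmax.
exists t1; split=> //; apply/eqP; rewrite eqn_leq rankf_ge //= leqNgt.
apply/negP => /(exchange_into t1B)[x [y [yF yt xt xF t2B]]].
have /tmax : P (y |: (t1 :\ x)).
  rewrite /P t2B; apply/fintype.subsetP => k kI; rewrite !inE.
  rewrite (fintype.subsetP It1) // andbT orbC; case: eqVneq => // kx.
  by rewrite -kx (fintype.subsetP IF) in xF.
rewrite /= leqNgt => /negP[]; apply: proper_card; apply/properP; split.
  apply/fintype.subsetP => k; rewrite !inE => /andP[kF kt]; rewrite kF kt.
  by rewrite andbT orbC; case: eqVneq => // kx; rewrite -kx kF in xF.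
by exists y; rewrite !inE ?eqxx ?yF // (negPf yt).
Qed.

(** [C :\ j] extends to a basis [t1] tight on [i |: s], hence contained in it by cardinality. [t1]
    misses [j] because [C] is dependent, which leaves only [i |: (s :\ j)]. *)
Lemma circuit_exchange s C i j : s \in B -> i \notin s -> circuit B C ->
  C \subset i |: s -> j \in C -> j != i -> i |: (s :\ j) \in B.
Proof.
move=> sB is_ [Cdep Cmin] Cs jC ji.
have js : j \in s by move: (fintype.subsetP Cs _ jC); rewrite !inE (negPf ji).
have [t tB Ct] := Cmin _ (properD1 jC).
have [] := @extend_tight _ (i |: s) t tB Ct.
  exact: fintype.subset_trans (subD1set _ _) Cs.
move=> t1 [t1B Ct1 t1F].
have t1s : t1 \subset i |: s.
  apply/finset.setIidPr/eqP; rewrite eqEcard finset.subsetIr t1F /= (rB t1B) -(rB sB).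
  have := rankf_ge (i |: s) sB; apply: leq_trans; apply/subset_leq_card.
  by rewrite finset.subsetI finset.subsetUr fintype.subxx.
have jt1 : j \notin t1.
  apply/negP => jt1; apply: Cdep; exists t1 => //.
  apply/fintype.subsetP => k kC; case: (eqVneq k j) => [->//|kj].
  by apply: (fintype.subsetP Ct1); rewrite !inE kj.
suff -> : i |: (s :\ j) = t1 by [].
apply/eqP; rewrite eq_sym eqEcard card_swap // (rB sB) (rB t1B) leqnn andbT.
apply/fintype.subsetP => k kt; move: (fintype.subsetP t1s _ kt); rewrite !inE.
by case: eqVneq => //= _ ->; rewrite andbT; apply: contraNneq jt1 => <-.
Qed.

Lemma exists_circuit (D : {set 'I_n}) : ~ indep B D ->
  exists2 C, circuit B C & C \subset D.
Proof.
move=> Ddep.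
pose P := fun C : {set 'I_n} => (C \subset D) && ~~ `[< indep B C >].
have Pd : P D by rewrite /P fintype.subxx; apply/asboolPn.
case: (arg_minnP (fun C : {set 'I_n} => #|C|) Pd) => C /andP[CD /asboolPn Cdep] Cmin.
exists C => //; split=> // E EC; apply: contrapT => Edep.
have := Cmin E; rewrite /P (fintype.subset_trans (proper_sub EC) CD) /=.
by move=> /(_ (introN (asboolP _) Edep)); rewrite leqNgt proper_card.
Qed.

Lemma fundamental_circuit s i : s \in B -> i \notin s ->
  exists C, [/\ circuit B C, C \subset i |: s & i \in C].
Proof.
move=> sB is_.
have [|C cC CD] := @exists_circuit (i |: s).
  move=> [t tB /subset_leq_card]; rewrite cardsU1 is_ (rB sB) (rB tB); lia.
exists C; split=> //; apply: contraT => iC.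
case: cC => []; case; exists s => //; apply/fintype.subsetP => k kC.
move: (fintype.subsetP CD _ kC); rewrite !inE; case: eqVneq => //= ki.
by rewrite -ki kC in iC.
Qed.

Section Connected.
Hypothesis cB : connected_matroid B.

(** For a circuit [C] through [i] and [j], a basis containing [C :\ j] cannot contain [j]. So on at
    least two elements a connected matroid has neither loops nor coloops. *)
Lemma connected_coloopless i j : i != j -> exists s, [/\ s \in B, i \in s & j \notin s].
Proof.
move=> ij; have [C [cC iC jC]] := cB ij.
case: (cC) => Cdep Cmin; have [s sB Cs] := Cmin _ (properD1 jC).
exists s; split=> //; first by apply: (fintype.subsetP Cs); rewrite !inE ij.
apply/negP => js; apply: Cdep; exists s => //.
apply/fintype.subsetP => k kC; case: (eqVneq k j) => [->//|kj].
by apply: (fintype.subsetP Cs); rewrite !inE kj.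
Qed.

(** Comparing weights on such a pair of bases isolates [i] against [j]; this is how connectedness
    enters the dimension counts. *)
Lemma connected_swap i j : i != j -> exists s,
  [/\ s \in B, j \in s, i \notin s & i |: (s :\ j) \in B].
Proof.
move=> ij; have [C [cC iC jC]] := cB ij.
case: (cC) => Cdep Cmin; have [s sB Cs] := Cmin _ (properD1 iC).
have Cs' : C \subset i |: s by rewrite -finset.subDset.
have is_ : i \notin s.
  apply/negP => is_; apply: Cdep; exists s => //.
  by move: Cs'; rewrite (finset.setUidPr _) // finset.sub1set.
exists s; split=> //.
  by apply: (fintype.subsetP Cs); rewrite !inE eq_sym ij.
by apply: (circuit_exchange sB is_ cC Cs' jC); rewrite eq_sym.
Qed.

End Connected.
End MatroidCombinatorics.

(** * Bases of maximal weight and the Bergman fan *)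

Section Weights.
Variables (R : realType) (n r : nat) (B : {set {set 'I_n}}).
Hypotheses (mB : is_matroid B) (rB : has_rank B r).
Implicit Types (F s t : {set 'I_n}) (u w x z : 'rV[R]_n).
Local Notation "w $ i" := (w ord0 i) (at level 1, i at level 9).

Lemma weight_incid F s : weight (incid R F) s = #|F :&: s|%:R.
Proof.
rewrite /weight (eq_bigr (fun i => if i \in F then 1 else 0 : R)); last first.
  by move=> i _; rewrite mxE; case: (i \in F).
rewrite -big_mkcondr /= sumr_const; congr (_ %:R).
by apply: eq_card => i; rewrite !inE andbC.
Qed.

Lemma weightD u w s : weight (u + w) s = weight u s + weight w s.
Proof. by rewrite -big_split; apply: eq_bigr => i _; rewrite mxE. Qed.

Lemma weightZ a w s : weight (a *: w) s = a * weight w s.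
Proof. by rewrite /weight mulr_sumr; apply: eq_bigr => i _; rewrite mxE. Qed.

Lemma weightN w s : weight (- w) s = - weight w s.
Proof. by rewrite -scaleN1r weightZ mulN1r. Qed.

Lemma weight_sum (I : finType) (P : pred I) (f : I -> 'rV[R]_n) s :
  weight (\sum_(k | P k) f k) s = \sum_(k | P k) weight (f k) s.
Proof.
rewrite [RHS]exchange_big; apply: eq_bigr => i _.
by rewrite summxE.
Qed.

Lemma weight_ones s : weight (ones R n) s = #|s|%:R.
Proof. by rewrite /weight (eq_bigr (fun=> 1)) ?sumr_const // => i _; rewrite mxE. Qed.

Lemma weight_setT w : weight w [set: 'I_n]%SET = \sum_i w$i.
Proof. by apply: eq_bigl => i; rewrite inE. Qed.

Lemma weight_swap w s i j : i \in s -> j \notin s ->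
  weight w (j |: (s :\ i)) = weight w s + w$j - w$i.
Proof.
move=> is_ js; rewrite /weight big_setU1 ?inE ?(negPf js) ?andbF //=.
by rewrite [in RHS](big_setD1 i) //=; ring.
Qed.

Lemma MwP w s :
  reflect (s \in B /\ forall t, t \in B -> weight w t <= weight w s)
          (s \in Mw B w).
Proof.
rewrite inE; apply: (iffP andP) => -[sB sM]; split=> //.
  by move=> t tB; apply: (implyP (forallP sM t)).
by apply/forallP => t; apply/implyP => /sM.
Qed.

Lemma exists_Mw w : exists s, s \in Mw B w.
Proof.
have [s0 s0B] := exists_basis mB.
case: (arg_maxP (fun s => weight w s) s0B) => s sB smax.
by exists s; apply/MwP.
Qed.

(** If [s] were not tight, an exchange into [F] would give a basis heavier than all bases are
    allowed to be. The gap is left general to serve both maximal bases and, later, nearly maximal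
    ones. *)
Lemma gap_tight w s F : s \in B ->
  (forall i j t, i \in F -> j \notin F -> t \in B ->
     weight w t < weight w s + w$i - w$j) ->
  #|F :&: s| = rankf B F.
Proof.
move=> sB gap; apply/eqP; rewrite eqn_leq rankf_ge //= leqNgt.
apply/negP => /(exchange_into mB rB sB)[i [j [jF js is_ iF tB]]].
by have := gap _ _ _ jF iF tB; rewrite weight_swap // ltxx.
Qed.

Lemma Mw_tight w s F : s \in Mw B w ->
  (forall i j, i \in F -> j \notin F -> w$j < w$i) -> #|F :&: s| = rankf B F.
Proof.
move=> /MwP[sB smax] up; apply: (gap_tight (w := w) sB) => i j t iF jF tB.
by rewrite -addrA (le_lt_trans (smax t tB)) // ltrDl subr_gt0 up.
Qed.

Lemma Mw_incidP F s : s \in Mw B (incid R F) <-> s \in B /\ #|F :&: s| = rankf B F.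
Proof.
split=> [sM|[sB sF]].
  split; first by case/MwP: sM.
  by apply: (Mw_tight sM) => i j iF jF; rewrite !mxE iF (negPf jF) ltr01.
apply/MwP; split=> // t tB; rewrite !weight_incid ler_nat sF.
exact: rankf_ge.
Qed.

(** An element [i] missing from a maximal basis can be swapped in along its fundamental circuit once
    another element of the circuit weighs no more. Conversely, a unique minimum [i] of a circuit [C]
    is a loop of [Mw B w], by a rank count on the set [F] of heavier elements, which contains
    [C :\ i]. *)
Lemma bergman_fanP w : bergman_fan B w <-> loopless (Mw B w).
Proof.
split=> [bw i|ll C [Cdep Cmin]].
  have [s sM] := exists_Mw w; have [is_|is_] := boolP (i \in s); first by exists s.
  have [sB smax] := MwP _ _ sM.
  have [C [cC Cs iC]] := fundamental_circuit rB sB is_.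
  have [k [ki [kC kmin]]] : exists k, k != i /\ (k \in C) /\ w$k <= w$i.
    have [k [l [kC lC kl kw kmin]]] := bw C cC.
    have [ki|ki] := eqVneq k i; last by exists k; split=> //; split=> //; apply: kmin.
    exists l; split; first by rewrite eq_sym -ki.
    by split=> //; rewrite -kw; apply: kmin.
  have ks : k \in s.
    by move: (fintype.subsetP Cs _ kC); rewrite !inE (negPf ki).
  exists (i |: (s :\ k)); last by rewrite !inE eqxx.
  apply/MwP; split; first exact: (circuit_exchange mB rB sB is_ cC Cs kC ki).
  move=> t tB; rewrite weight_swap // (le_trans (smax t tB)) //.
  by rewrite -addrA lerDl subr_ge0.
have [i0 i0C] : exists i, i \in C.
  apply/set0Pn/eqP => C0; apply: Cdep; have [s sB] := exists_basis mB.
  by exists s => //; rewrite C0 finset.sub0set.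
case: (arg_minP (fun i => w$i) i0C) => i iC imin.
suff [j [jC ij jw]] : exists j, [/\ j \in C, i != j & w$j <= w$i].
  exists i, j; split=> //; apply/eqP; rewrite eq_le jw andbT.
  exact: imin.
apply: contrapT => nex.
have up j : j \in C -> i != j -> w$i < w$j.
  by move=> jC ij; rewrite ltNge; apply/negP => le; apply: nex; exists j.
pose F : {set 'I_n} := [set j | w$i < w$j]%SET.
have [s sM is_] := ll i; have [sB _] := MwP _ _ sM.
have sF : #|F :&: s| = rankf B F.
  apply: (Mw_tight sM) => k l; rewrite !inE -leNgt => wk wl.
  exact: le_lt_trans wl wk.
have iF : i \notin F by rewrite inE ltxx.
have [t tB Ct] := Cmin _ (properD1 iC).
(* [s] contains [i] and is tight on [F], so [i |: F] has larger rank than [F]. A basis containing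
   [C :\ i] and tight on [i |: F] then contains all of [C], or exceeds the rank of [F] on [F]; both
   are absurd. *)
have [|t1 [t1B Ct1 t1F]] := @extend_tight _ _ _ mB rB (C :\ i) (i |: F) t tB Ct.
  by apply/fintype.subsetP => k; rewrite !inE => /andP[ki kC]; rewrite up ?orbT // eq_sym.
have := rankf_ge (i |: F) sB; rewrite -t1F !finset.setIUl.
have := rankf_ge F t1B; rewrite -sF.
have -> : [set i]%SET :&: s = [set i]%SET by apply/finset.setIidPl; rewrite finset.sub1set.
rewrite cardsU1 !inE is_ ltxx /= => le1.
case: (boolP (i \in t1)) => it1.
  move=> _; apply: Cdep; exists t1 => //; apply/fintype.subsetP => k kC.
  have [->//|ki] := eqVneq k i.
  by apply: (fintype.subsetP Ct1); rewrite !inE ki.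
have -> : [set i]%SET :&: t1 = finset.set0.
  by apply/setP => k; rewrite !inE; case: eqVneq => // ->; rewrite (negPf it1).
by rewrite finset.set0U add1n ltnNge le1.
Qed.

Lemma continuous_coord i : continuous (fun w : 'rV[R]_n => w$i).
Proof. exact: coord_continuous. Qed.

Lemma for_continuous_sum (T : topologicalType) (W : normedModType R) (I : Type)
    (l : seq I) (P : pred I) (f : I -> T -> W) (p : T) :
  (forall k, P k -> {for p, continuous (f k)}) ->
  {for p, continuous (fun z : T => \sum_(k <- l | P k) f k z)}.
Proof.
move=> fc; rewrite /prop_for /continuous_at; apply: cvg_big.
  exact: add_continuous.
exact: fc.
Qed.

Lemma for_continuous_prod (T : topologicalType) (I : Type)
    (l : seq I) (P : pred I) (f : I -> T -> R) (p : T) :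
  (forall k, P k -> {for p, continuous (f k)}) ->
  {for p, continuous (fun z : T => \prod_(k <- l | P k) f k z)}.
Proof.
move=> fc; rewrite /prop_for /continuous_at; apply: cvg_big.
  exact: mul_continuous.
exact: fc.
Qed.

Lemma weight_continuous s : continuous (fun w : 'rV[R]_n => weight w s).
Proof. by move=> w; apply: for_continuous_sum => i _; apply: continuous_coord. Qed.

(** The inequalities stating that a basis of [Mw B w] is maximal are weak, so they survive in the
    closure. *)
Lemma fan_cone_sub w w' : fan_cone B w w' -> Mw B w \subset Mw B w'.
Proof.
move=> ww'; apply/fintype.subsetP => s sM; have [sB _] := MwP _ _ sM.
apply/MwP; split=> // t tB.
have cl : closed [set u : 'rV[R]_n | 0 <= weight u s - weight u t].
  apply: (@preimage_closed _ _ (fun u => weight u s - weight u t) [set a | 0 <= a]).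
    by move=> u _; apply: continuousB; exact: weight_continuous.
  exact: closed_ge.
rewrite -subr_ge0; apply: cl; apply: closureS ww' => u /= uw.
by rewrite subr_ge0; rewrite -uw in sM; case/MwP: sM => _; apply.
Qed.

Lemma bergman_fan_cones :
  bergman_fan B = \bigcup_(w in [set w : 'rV[R]_n | loopless (Mw B w)]) fan_cone B w.
Proof.
apply/seteqP; split=> w.
  by move=> /bergman_fanP lw; exists w => //; apply: subset_closure.
move=> [u /= lu /fan_cone_sub uw]; apply/bergman_fanP => i.
by have [s su is_] := lu i; exists s => //; apply: (fintype.subsetP uw).
Qed.

End Weights.

(** * The base polytope and its rank inequalities *)

Section BasePolytope.
Variables (R : realType) (n r : nat) (B : {set {set 'I_n}}).
Hypotheses (mB : is_matroid B) (rB : has_rank B r).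
Implicit Types (F s t : {set 'I_n}) (u w x y z : 'rV[R]_n).
Local Notation "w $ i" := (w ord0 i) (at level 1, i at level 9).
Local Notation e_ := (incid R).

Definition dot u x : R := \sum_i u$i * x$i.

Lemma dotDl u w x : dot (u + w) x = dot u x + dot w x.
Proof. by rewrite -big_split; apply: eq_bigr => i _; rewrite mxE mulrDl. Qed.

Lemma dotZl a u x : dot (a *: u) x = a * dot u x.
Proof. by rewrite /dot mulr_sumr; apply: eq_bigr => i _; rewrite mxE mulrA. Qed.

Lemma dotC u x : dot u x = dot x u.
Proof. by apply: eq_bigr => i _; rewrite mulrC. Qed.

Lemma dotDr u x y : dot u (x + y) = dot u x + dot u y.
Proof. by rewrite dotC dotDl ![dot _ u]dotC. Qed.

Lemma dotZr a u x : dot u (a *: x) = a * dot u x.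
Proof. by rewrite dotC dotZl dotC. Qed.

Lemma dot_expand u x a :
  dot (u + a *: x) (u + a *: x) = dot u u + a * dot u x *+ 2 + a ^+ 2 * dot x x.
Proof. by rewrite dotDl !dotDr !dotZl !dotZr (dotC x u); ring. Qed.

Lemma dotNr u x : dot u (- x) = - dot u x.
Proof. by rewrite -scaleN1r dotZr mulN1r. Qed.

Lemma dot_sumr (I : finType) (P : pred I) (f : I -> 'rV[R]_n) u :
  dot u (\sum_(k | P k) f k) = \sum_(k | P k) dot u (f k).
Proof.
rewrite [RHS]exchange_big; apply: eq_bigr => i _.
by rewrite summxE mulr_sumr.
Qed.

Lemma dot_incidr u F : dot u (e_ F) = weight u F.
Proof.
rewrite /dot /weight [RHS]big_mkcond; apply: eq_bigr => i _; rewrite mxE.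
by case: (i \in F); rewrite ?mulr1 ?mulr0.
Qed.

Lemma dot_onesl x : dot (ones R n) x = \sum_i x$i.
Proof. by apply: eq_bigr => i _; rewrite mxE mul1r. Qed.

Lemma dot_ge0 u : 0 <= dot u u.
Proof. by apply: sumr_ge0 => i _; rewrite -expr2 sqr_ge0. Qed.

Lemma dot_eq0 u : dot u u <= 0 -> u = 0.
Proof.
move=> u0; apply/rowP => i; rewrite mxE; apply/eqP; rewrite -sqrf_eq0 expr2.
have /eqP : dot u u == 0 by rewrite eq_le u0 dot_ge0.
move/psumr_eq0P => -> // k _; by rewrite -expr2 sqr_ge0.
Qed.

Lemma polytope_incid (T : {set {set 'I_n}}) s : s \in T -> polytope T (e_ s).
Proof.
move=> sT; exists (fun t => (t == s)%:R); split=> [t||].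
- by case: eqP => _; rewrite ?ler01.
- by rewrite (bigD1 s) //= eqxx big1 ?addr0 // => t /andP[_ /negPf->].
- rewrite (bigD1 s) //= eqxx scale1r big1 ?addr0 // => t /andP[_ /negPf->].
  by rewrite scale0r.
Qed.

Lemma polytope_convex (T : {set {set 'I_n}}) x y a : 0 <= a <= 1 ->
  polytope T x -> polytope T y -> polytope T ((1 - a) *: x + a *: y).
Proof.
move=> /andP[a0 a1] [l [l0 l1 ->]] [k [k0 k1 ->]].
exists (fun s => (1 - a) * l s + a * k s); split=> [s||].
- by rewrite addr_ge0 // mulr_ge0 // subr_ge0.
- by rewrite big_split /= -!mulr_sumr l1 k1 !mulr1 subrK.
- rewrite !scaler_sumr -big_split; apply: eq_bigr => s _ /=.
  by rewrite [RHS]scalerDl !scalerA.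
Qed.

Lemma polytope_sum x : polytope B x -> \sum_i x$i = r%:R.
Proof.
case=> l [_ l1 ->]; rewrite -dot_onesl dot_sumr.
rewrite (eq_bigr (fun s => l s * r%:R)) => [|s sB].
  by rewrite -mulr_suml l1 mul1r.
by rewrite dotZr dot_incidr weight_ones (rB sB).
Qed.

Lemma polytope_dot_le (T : {set {set 'I_n}}) w x c : polytope T x ->
  (forall s, s \in T -> weight w s <= c) -> dot w x <= c.
Proof.
case=> l [l0 l1 ->] wc; rewrite dot_sumr -[c]mul1r -l1 mulr_suml.
by apply: ler_sum => s sB; rewrite dotZr dot_incidr ler_wpM2l // wc.
Qed.

Lemma weight_dot x F : weight x F = dot (e_ F) x.
Proof. by rewrite dotC dot_incidr. Qed.

Lemma polytope_le x F : polytope B x -> weight x F <= (rankf B F)%:R.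
Proof.
move=> Px; rewrite weight_dot; apply: polytope_dot_le Px _ => s sB.
by rewrite weight_incid ler_nat rankf_ge.
Qed.

Lemma polytope_ge0 (T : {set {set 'I_n}}) x i : polytope T x -> 0 <= x$i.
Proof.
case=> l [l0 _ ->]; rewrite summxE; apply: sumr_ge0 => s _.
by rewrite !mxE mulr_ge0.
Qed.

(** Induction on the size of the support [S]. Subtracting the least positive value times [e_ S]
    shrinks the support, [S] is itself a superlevel set, and the superlevel sets of the remainder
    are superlevel sets of [w]. *)
Lemma dot_le0_nonneg m w z :
  (#|[set i | w$i != 0%R]%SET| <= m)%N -> (forall i, 0 <= w$i) ->
  (forall F, (forall i j, i \in F -> j \notin F -> w$j < w$i) ->
     weight z F <= 0) ->
  dot w z <= 0.
Proof.
elim: m w => [|m IHm] w; set S := [set i | w$i != 0]%SET => cS w0 up.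
all: have [S0|[k0 k0S]] := set_0Vmem S.
- by rewrite /dot big1 // => i _; move/setP/(_ i): S0; rewrite !inE => /negbFE/eqP->; rewrite mul0r.
- by move: cS; rewrite leqNgt card_gt0 (_ : S != finset.set0) //; apply/set0Pn; exists k0.
- by rewrite /dot big1 // => i _; move/setP/(_ i): S0; rewrite !inE => /negbFE/eqP->; rewrite mul0r.
case: (arg_minP (fun i => w$i) k0S) => k kS kmin.
have {}kS : k \in S by [].
have c0 : 0 < w$k by move: kS; rewrite inE lt_def w0 andbT.
have wS i : i \notin S -> w$i = 0 by rewrite inE => /negbNE/eqP.
pose w' := w + (- w$k) *: e_ S.
have w'E i : w'$i = if i \in S then w$i - w$k else 0.
  by rewrite !mxE; case: (boolP (i \in S)) => [iS|/wS->]; rewrite ?mulr1 ?mulr0 ?addr0.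
have -> : w = w' + w$k *: e_ S by rewrite /w' -addrA -scalerDl addNr scale0r addr0.
rewrite dotDl dotZl -weight_dot.
have zS : weight z S <= 0.
  by apply: up => i j iS /wS->; rewrite lt_def w0 andbT; rewrite inE in iS.
rewrite -[0]addr0 lerD ?pmulr_rle0 //; apply: IHm => [|i|F Fup].
- rewrite -ltnS; apply: leq_trans cS; apply: proper_card; apply/properP; split.
    apply/fintype.subsetP => i; rewrite inE w'E; case: ifP => // _.
    by rewrite eqxx.
  by exists k => //; rewrite inE w'E kS subrr eqxx.
- by rewrite w'E; case: ifP => // iS; rewrite subr_ge0 kmin.
- apply: up => i j iF jF; have := Fup i j iF jF; rewrite !w'E.
  case: ifP => jS; case: ifP => iS; rewrite ?ltrD2r ?ltxx //.
    by rewrite ltNge subr_ge0 kmin.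
  by move=> lt; rewrite (wS _ (negbT jS)) (lt_trans c0) // -subr_gt0.
Qed.

(* Abel summation along the superlevel sets of [w]. *)
Lemma dot_le0_upper w z : \sum_i z$i = 0 ->
  (forall F, (forall i j, i \in F -> j \notin F -> w$j < w$i) ->
     weight z F <= 0) ->
  dot w z <= 0.
Proof.
move=> z0 up; pose c := \sum_i `|w$i|; pose w' := w + c *: ones R n.
have w'E i : w'$i = w$i + c by rewrite !mxE mulr1.
have -> : dot w z = dot w' z by rewrite dotDl dotZl dot_onesl z0 mulr0 addr0.
apply: (@dot_le0_nonneg n) => [|i|F Fup].
- by rewrite -[X in (_ <= X)%N]card_ord max_card.
- rewrite w'E /c (bigD1 i) //= addrA addr_ge0 ?sumr_ge0 //.
  by rewrite -lerBlDl sub0r -normrN ler_norm.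
- by apply: up => i j iF jF; have := Fup i j iF jF; rewrite !w'E ltrD2r.
Qed.

Lemma polytope_compact : compact (polytope B : set 'rV[R]_n).
Proof.
pose K := [set v : 'rV[R]_#|B| | forall k, `[0, 1]%classic (v ord0 k)]
          `&` [set v | \sum_k v ord0 k = 1].
pose f (v : 'rV[R]_#|B|) := \sum_k v ord0 k *: e_ (enum_val k).
have -> : polytope B = f @` K.
  apply/seteqP; split=> x.
    case=> l [l0 l1 ->]; exists (\row_k l (enum_val k)).
      have sE : \sum_k (\row_k l (enum_val k) : 'rV[R]_#|B|) ord0 k = 1.
        by rewrite -l1 [RHS]big_enum_val; apply: eq_bigr => k _; rewrite mxE.
      split=> //= k; rewrite in_itv /= mxE l0 /= -l1 (bigD1 (enum_val k)) ?enum_valP //=.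
      by rewrite lerDl sumr_ge0.
    by rewrite [RHS]big_enum_val; apply: eq_bigr => k _; rewrite mxE.
  case=> v [v01 v1] <-; have v0 k : 0 <= v ord0 k by have := v01 k; rewrite /= in_itv => /andP[].
  exists (fun s => \sum_(k | enum_val k == s) v ord0 k); split=> [s||].
  - by rewrite sumr_ge0.
  - rewrite -[RHS]v1 [RHS](partition_big (fun k => enum_val k) (mem B)) //= => k _.
    exact: enum_valP.
  - rewrite /f (partition_big (fun k => enum_val k) (mem B)) /= => [|k _]; last exact: enum_valP.
    by apply: eq_bigr => s _; rewrite scaler_suml; apply: eq_bigr => k /eqP->.
apply: continuous_compact.
  apply: continuous_subspaceT => v; apply: for_continuous_sum => k _.
  by apply: continuousZr_tmp; exact: coord_continuous.
apply: compact_closedI.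
  have := @rV_compact R #|B| (fun=> `[0, 1]%classic : set R).
  apply => _; exact: segment_compact.
apply: (@preimage_closed _ _ (fun v : 'rV[R]_#|B| => \sum_k v ord0 k) [set a : R | a = 1]).
  by move=> v _; apply: for_continuous_sum => k _; exact: coord_continuous.
exact: closed_eq.
Qed.

(** For the converse, let [y] be the point of the polytope nearest to [x] and [w = x - y].
    Minimality gives [dot w (e_ s) <= dot w y] for every basis, while Abel summation bounds
    [dot w x] by the value at a maximal basis; so [dot w w <= 0]. *)
Lemma polytopeP x : polytope B x <->
  \sum_i x$i = r%:R /\ forall F, weight x F <= (rankf B F)%:R.
Proof.
split=> [Px|[xr xF]].
  by split=> [|F]; [exact: polytope_sum | exact: polytope_le].
have [y yP ymin] : exists2 y, y \in (polytope B : set 'rV[R]_n) &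
    forall t : 'rV[R]_n, t \in (polytope B : set 'rV[R]_n) ->
      dot (x - y) (x - y) <= dot (x - t) (x - t).
  apply: compact_EVT_min.
  - by have [s sB] := exists_basis mB; exists (e_ s); exact: polytope_incid.
  - exact: polytope_compact.
  - have -> : (fun y => dot (x - y) (x - y)) = fun y => \sum_i (x$i - y$i) * (x$i - y$i).
      by apply/funext => y; apply: eq_bigr => i _; rewrite !mxE.
    apply: continuous_subspaceT => y; apply: for_continuous_sum => i _.
    have c : {for y, continuous (fun z : 'rV[R]_n => x$i - z$i)}.
      by apply: continuousB; [exact: cst_continuous | exact: coord_continuous].
    exact: continuousM.
rewrite inE in yP; pose w := x - y.
have wy s : s \in B -> weight w s <= dot w y.
  move=> sB; rewrite -dot_incidr -subr_le0 -dotNr -dotDr.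
  set d := e_ s - y; rewrite leNgt; apply/negP => wd.
  pose D := dot d d; have D0 : 0 <= D by exact: dot_ge0.
  have a0 : 0 < dot w d + D by rewrite ltr_wpDr.
  (* Moving from [y] towards [e_ s] by the fraction [a] changes the squared distance by
     [a ^+ 2 * D - 2 * a * dot w d]; this choice keeps [a <= 1] and makes the change negative. *)
  pose a := dot w d / (dot w d + D).
  have ha : 0 < a by rewrite divr_gt0.
  have a1 : a <= 1 by rewrite ler_pdivrMr // mul1r lerDl.
  have /mem_set/ymin : polytope B ((1 - a) *: y + a *: e_ s).
    apply: polytope_convex => //; first by rewrite ltW.
    exact: polytope_incid.
  have -> : x - ((1 - a) *: y + a *: e_ s) = w + (- a) *: d.
    by apply/rowP => i; rewrite !mxE; ring.
  rewrite -/w dot_expand -/D.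
  have aE : a * (dot w d + D) = dot w d by rewrite divfK // gt_eqF.
  nra.
have [s sM] := exists_Mw mB w; have [sB _] := MwP _ _ _ sM.
have : dot w (x - e_ s) <= 0.
  apply: dot_le0_upper => [|F Fup].
    rewrite -weight_setT weightD weightN !weight_setT xr.
    by rewrite (polytope_sum (polytope_incid sB)) subrr.
  rewrite weightD weightN weight_incid finset.setIC (Mw_tight mB rB sM Fup) subr_le0.
  exact: xF.
rewrite dotDr dotNr dot_incidr subr_le0 => wx.
have /dot_eq0 w0 : dot w w <= 0.
  by rewrite {2}/w dotDr dotNr subr_le0 (le_trans wx) // wy.
by move: yP; rewrite -(subrK y x) -/w w0 add0r.
Qed.

Lemma polytope_closed : closed (polytope B : set 'rV[R]_n).
Proof. by apply: compact_closed; [exact: norm_hausdorff | exact: polytope_compact]. Qed.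

End BasePolytope.

(** * Affine dimension of polytopes and of rays *)

Section AffineDimension.
Variables (R : realType) (n : nat).
Implicit Types (F s : {set 'I_n}) (T : {set {set 'I_n}}) (u w x y : 'rV[R]_n).
Local Notation "w $ i" := (w ord0 i) (at level 1, i at level 9).
Local Notation e_ := (incid R).
Local Notation one_ := (ones R n).

Lemma row_free_rowsub (m k p : nat) (A : 'M[R]_(m, p)) (f : 'I_k -> 'I_m) :
  injective f -> row_free A -> row_free (rowsub f A).
Proof.
move=> f_inj fA; apply: inj_row_free => v.
rewrite rowsubE mulmxA => /eqP; rewrite mulmx_free_eq0 // => /eqP v0.
apply/rowP => i; have := congr1 (fun M : 'rV_m => M ord0 (f i)) v0; rewrite !mxE.
rewrite (bigD1 i) //= !mxE eqxx mulr1 big1 ?addr0 // => j ji.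
by rewrite !mxE (inj_eq f_inj) (negPf ji) mulr0.
Qed.

Lemma aff_indep_leq_rank k m (p : 'I_k.+1 -> 'rV[R]_n) (U : 'M[R]_(m, n)) :
  (forall i, p i - p ord0 <= U)%MS -> aff_indep p -> (k <= \rank U)%N.
Proof.
move=> pU /eqP fp; rewrite -[X in (X <= _)%N]fp; apply: mxrankS.
by apply/row_subP => i; rewrite rowK.
Qed.

(** For [s0] in [T], the row space is the direction space of the affine hull of [polytope T], so the
    rank is its dimension. *)
Definition diffmx T s0 : 'M[R]_(#|T|, n) :=
  \matrix_(k < #|T|) (e_ (enum_val k) - e_ s0).

Lemma polytope_sub_diffmx T s0 x : polytope T x -> (x - e_ s0 <= diffmx T s0)%MS.
Proof.
case=> l [_ l1 ->]; rewrite -[e_ s0]scale1r -l1 scaler_suml -sumrB.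
apply: summx_sub => s sT; rewrite -scalerBr; apply: scalemx_sub.
have := row_sub (enum_rank_in sT s) (diffmx T s0).
by rewrite rowK enum_rankK_in.
Qed.

Lemma polytope_aff_indepP T s0 k : s0 \in T ->
  (exists p : 'I_k.+1 -> 'rV[R]_n, (forall i, polytope T (p i)) /\ aff_indep p)
  <-> (k <= \rank (diffmx T s0))%N.
Proof.
move=> s0T; split=> [[p [pT fp]]|le].
  apply: aff_indep_leq_rank fp => i.
  rewrite -[p i](subrK (e_ s0)) -addrA addmx_sub ?polytope_sub_diffmx //.
  by rewrite -opprB eqmx_opp polytope_sub_diffmx.
pose f (j : 'I_k) := maxrankfun (diffmx T s0) (widen_ord le j).
pose p (i : 'I_k.+1) : 'rV[R]_n :=
  if unlift ord0 i is Some j then e_ (enum_val (f j)) else e_ s0.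
exists p; split=> [i|].
  by rewrite /p; case: unlift => [j|]; apply: polytope_incid => //; exact: enum_valP.
rewrite /aff_indep; set M := (X in row_free X).
have -> : M = rowsub (widen_ord le) (rowsub (maxrankfun (diffmx T s0)) (diffmx T s0)).
  apply/row_matrixP => i; rewrite rowK !row_rowsub rowK.
  by rewrite /p liftK unlift_none.
apply: row_free_rowsub; last exact: maxrowsub_free.
by move=> i j /(congr1 val)/= /val_inj.
Qed.

Lemma has_affdim_polytope T s0 d : s0 \in T ->
  has_affdim (polytope T : set 'rV[R]_n) d <-> \rank (diffmx T s0) = d.
Proof.
move=> s0T; rewrite /has_affdim !(polytope_aff_indepP _ s0T).
split=> [[le nle]|->]; first by apply/eqP; rewrite eqn_leq le andbT leqNgt; apply/negP.
by split=> //; rewrite ltnn.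
Qed.

(** When [polytope T] is a face, this kernel is the linear span of its normal cone; with
    rank-nullity, the dimensions of a face and of its normal cone are complementary. *)
Lemma ker_diffmxP T s0 u : s0 \in T ->
  (u <= kermx (diffmx T s0)^T)%MS <-> (forall s, s \in T -> weight u s = weight u s0).
Proof.
move=> s0T; rewrite sub_kermx.
have E k : (u *m (diffmx T s0)^T)$k = weight u (enum_val k) - weight u s0.
  rewrite -!dot_incidr -dotNr -dotDr mxE; apply: eq_bigr => i _.
  by rewrite !mxE.
split=> [/eqP u0 s sT|uc].
  have := E (enum_rank_in sT s); rewrite u0 mxE enum_rankK_in // => /esym/eqP.
  by rewrite subr_eq0 => /eqP.
by apply/eqP/rowP => k; rewrite E mxE uc ?subrr // enum_valP.
Qed.

Lemma rank_ker_diffmx T s0 :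
  (\rank (diffmx T s0) + \rank (kermx (diffmx T s0)^T) = n)%N.
Proof. by rewrite mxrank_ker mxrank_tr subnKC // rank_leq_col. Qed.

Definition spanmx F : 'M[R]_(1 + 1, n) := col_mx (e_ F) one_.

Lemma spanmxP F u :
  (u <= spanmx F)%MS <-> exists a t, u = a *: e_ F + t *: one_.
Proof.
split=> [/submxP[v ->]|[a [t ->]]].
  rewrite -[v]hsubmxK mul_row_col [lsubmx v]mx11_scalar [rsubmx v]mx11_scalar.
  by rewrite !mul_scalar_mx; eexists; eexists.
by rewrite /spanmx -addsmxE addmx_sub_adds // scalemx_sub.
Qed.

Lemma span_eq0 F i j a t : i \in F -> j \notin F ->
  a *: e_ F + t *: one_ = 0 -> a = 0 /\ t = 0.
Proof.
move=> iF jF E; have t0 : t = 0.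
  have := congr1 (fun u => u$j) E.
  by rewrite !mxE (negPf jF) mulr0 add0r mulr1.
split=> //; have := congr1 (fun u => u$i) E.
by rewrite !mxE iF t0 mul0r addr0 mulr1.
Qed.

Lemma spanmx_free F i j : i \in F -> j \notin F -> row_free (spanmx F).
Proof.
move=> iF jF; apply: inj_row_free => v.
rewrite -[v]hsubmxK mul_row_col [lsubmx v]mx11_scalar [rsubmx v]mx11_scalar.
rewrite !mul_scalar_mx => /(span_eq0 iF jF)[-> ->].
by rewrite !raddf0 row_mx0.
Qed.

(** [e_ F] and [one_] are independent because [F] is nonempty and proper, so [u] can add no further
    direction. The relevant dimension is 2 because a ray contains the line spanned by [one_]. *)
Lemma affdim2_dependent (G : set 'rV[R]_n) F i j x u : i \in F -> j \notin F ->
  has_affdim G 2 -> G x -> G (x + e_ F) -> G (x + one_) -> G (x + u) ->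
  exists a t, u = a *: e_ F + t *: one_.
Proof.
move=> iF jF [_ nG] G0 G1 G2 G3; apply: contrapT => nu; apply: nG.
pose d (k : 'I_3) : 'rV[R]_n := tnth [tuple e_ F; one_; u] k.
exists (fun k => if unlift ord0 k is Some l then x + d l else x); split.
  move=> k; case: unliftP => [l _|//].
  by case: l => [[|[|[|//]]] ?]; rewrite /d (tnth_nth 0) /=.
apply: inj_row_free => v.
rewrite mulmx_sum_row !big_ord_recl big_ord0 !rowK !liftK unlift_none addr0.
rewrite ![_ + d _ - _]addrC !addKr /d !(tnth_nth 0) /=.
set a := v$_; set t := v$_; set b := v$_ => E.
have b0 : b = 0.
  apply/eqP/negPn/negP => nb; apply: nu; exists (- (b^-1 * a)), (- (b^-1 * t)).
  apply: (scalerI nb); rewrite scalerDr !scalerA !mulrN !mulVKf // !scaleNr.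
  by rewrite -opprD; apply/eqP; rewrite -addr_eq0 addrC -addrA E.
move: E; rewrite b0 scale0r addr0 => /(span_eq0 iF jF)[a0 t0].
apply/rowP => k; rewrite mxE -[RHS]b0.
case: k => [[|[|[|//]]] ?].
- by rewrite b0 -a0; congr (v _ _); apply: val_inj.
- by rewrite b0 -t0; congr (v _ _); apply: val_inj.
- by congr (v _ _); apply: val_inj.
Qed.

Lemma has_affdim_ray F i j : i \in F -> j \notin F -> has_affdim (@ray_of R n F) 2.
Proof.
move=> iF jF; split.
  exists (fun k : 'I_3 => tnth [tuple 0; e_ F; one_] k); split=> [k|].
    case: k => [[|[|[|//]]] ?]; rewrite (tnth_nth 0) /=.
    - by exists 0, 0; rewrite !scale0r addr0.
    - by exists 1, 0; rewrite scale0r addr0 scale1r ler01.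
    - by exists 0, 1; rewrite scale0r add0r scale1r.
  apply: inj_row_free => v.
  rewrite mulmx_sum_row !big_ord_recl big_ord0 !rowK !(tnth_nth 0) /= addr0 !subr0.
  move=> /(span_eq0 iF jF)[a0 t0]; apply/rowP => k; rewrite mxE.
  case: k => [[|[|//]] ?].
  - by rewrite -[RHS]a0; congr (v _ _); apply: val_inj.
  - by rewrite -[RHS]t0; congr (v _ _); apply: val_inj.
case=> p [pF fp]; suff : (3 <= 2)%N by [].
apply: leq_trans (rank_leq_row (spanmx F)); apply: aff_indep_leq_rank fp => k.
have sp l : (p l <= spanmx F)%MS.
  by have [a [t [_ ->]]] := pF l; apply/spanmxP; exists a, t.
by rewrite addmx_sub // eqmx_opp.
Qed.

End AffineDimension.

(** * Rays of the Bergman fan and flacets *)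

Section Rays.
Variables (R : realType) (n r : nat) (B : {set {set 'I_n}}).
Hypotheses (mB : is_matroid B) (rB : has_rank B r).
Implicit Types (F s : {set 'I_n}) (u w x y : 'rV[R]_n).
Local Notation "w $ i" := (w ord0 i) (at level 1, i at level 9).
Local Notation e_ := (incid R).
Local Notation one_ := (ones R n).

Lemma Mw_subset w : Mw B w \subset B.
Proof. by apply/fintype.subsetP => s /MwP[]. Qed.

(** Some basis maximises both weights, so a maximiser of the sum must maximise each of them. *)
Lemma MwD u w : Mw B u \subset Mw B w -> Mw B (u + w) = Mw B u.
Proof.
move=> /fintype.subsetP uw; apply/setP => s; apply/idP/idP => [/MwP[sB smax]|su].
  apply/MwP; split=> // t tB; have [k ku] := exists_Mw mB u.
  have [kB kmax] := MwP _ _ _ ku; have [_ kw] := MwP _ _ _ (uw _ ku).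
  have := smax k kB; have := kw s sB; have := kmax t tB; rewrite !weightD; lra.
have [sB su'] := MwP _ _ _ su; have [_ sw] := MwP _ _ _ (uw _ su).
by apply/MwP; split=> // t tB; rewrite !weightD lerD ?su' ?sw.
Qed.

Lemma MwZ a w : 0 < a -> Mw B (a *: w) = Mw B w.
Proof.
move=> a0; apply/setP => s; apply/MwP/MwP => -[sB smax]; split=> // t tB;
  by have := smax t tB; rewrite !weightZ ler_pM2l.
Qed.

Lemma Mw_const a : Mw B (a *: one_) = B.
Proof.
apply/setP => s; apply/MwP/idP => [[]//|sB]; split=> // t tB.
by rewrite !weightZ !weight_ones (rB sB) (rB tB).
Qed.

Lemma Mw_affine a t w : 0 < a -> Mw B (a *: w + t *: one_) = Mw B w.
Proof. by move=> a0; rewrite MwD; [exact: MwZ | rewrite Mw_const Mw_subset]. Qed.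

Lemma Mw_upper F w : (forall i j, i \in F -> j \notin F -> w$j < w$i) ->
  Mw B w \subset Mw B (e_ F).
Proof.
move=> up; apply/fintype.subsetP => s sM; apply/(Mw_incidP R mB rB).
by split; [case/MwP: sM | exact: (Mw_tight mB rB sM up)].
Qed.

Lemma fan_cone_eq w w' : Mw B w = Mw B w' -> fan_cone B w = fan_cone B w'.
Proof. by rewrite /fan_cone => ->. Qed.

Lemma fan_cone_refl w w' : Mw B w' = Mw B w -> fan_cone B w w'.
Proof. by move=> E; apply: subset_closure. Qed.

(* Weights outside [Mw B w] are bounded away from the maximum, so the normal
   cone is relatively open. *)
Lemma Mw_perturb w u :
  (forall s t, s \in Mw B w -> t \in Mw B w -> weight u s = weight u t) ->
  exists2 a, 0 < a & Mw B (w + a *: u) = Mw B w.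
Proof.
move=> uc; pose U := \sum_i `|u$i|.
have U0 : 0 <= U by apply: sumr_ge0.
have uU s : `|weight u s| <= U.
  rewrite /weight (le_trans (ler_norm_sum _ _ _)) // /U.
  by rewrite [leRHS](bigID (mem s)) /= lerDl sumr_ge0.
have [t tM] := exists_Mw mB w; have [tB tmax] := MwP _ _ _ tM.
have [g g0 gap] : exists2 g, 0 < g &
    forall s, s \in B -> s \notin Mw B w -> weight w s + g <= weight w t.
  have [E|[s1 s1D]] := set_0Vmem (B :\: Mw B w).
    exists 1 => // s sB sM; move/setP/(_ s): E.
    by rewrite finset.in_setD sB sM finset.in_set0.
  case: (arg_maxP (fun s => weight w s) s1D) => s2 s2D smax.
  have {}s2D : s2 \in B :\: Mw B w by [].
  move: s2D; rewrite finset.in_setD => /andP[s2M s2B].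
  exists (weight w t - weight w s2).
    rewrite subr_gt0 lt_neqAle tmax // andbT; apply: contra s2M => /eqP E.
    by apply/MwP; split=> // k kB; rewrite E tmax.
  move=> s sB sM.
  have : weight w s <= weight w s2.
    by apply: smax; have : s \in B :\: Mw B w by rewrite finset.in_setD sM.
  lra.
(* [g] bounds from below the gap between maximal and other weights, and adding [a *: u] changes the
   difference of two weights by at most [2 * a * U], which is below [g]. *)
pose a := g / (2 * U + 1); have a0 : 0 < a by rewrite divr_gt0 //; lra.
have aE : a * (2 * U + 1) = g by rewrite divfK // gt_eqF //; lra.
exists a => //; apply/setP => s; apply/MwP/idP => [[sB smax]|sM].
  apply: contraT => /(gap _ sB) le; have := smax t tB; rewrite !weightD !weightZ.
  have := uU s; have := uU t; rewrite !ler_norml => /andP[? ?] /andP[? ?]; nra.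
have [sB smax] := MwP _ _ _ sM; split=> // k kB; rewrite !weightD !weightZ.
have [kM|/(gap _ kB) le] := boolP (k \in Mw B w); first by rewrite (uc s k) // lerD2r smax.
have := uU s; have := uU k; rewrite !ler_norml => /andP[? ?] /andP[? ?].
have := smax t tB; nra.
Qed.

Hypothesis cB : connected_matroid B.

Lemma const_weight u : (forall s t, s \in B -> t \in B -> weight u s = weight u t) ->
  forall i j, u$i = u$j.
Proof.
move=> uc i j; have [->//|ij] := eqVneq i j.
have [s [sB js is_ tB]] := connected_swap mB rB cB ij.
by have := uc _ _ tB sB; rewrite weight_swap //; lra.
Qed.

(** Swapping [i] in for [j] raises the intersection with [F], so the basis before the swap is not
    tight. Hence a nonempty proper [F] cuts out a proper face. *)
Lemma exists_slack F i j : i \in F -> j \notin F ->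
  exists2 s, s \in B & (#|F :&: s| < rankf B F)%N.
Proof.
move=> iF jF; have ij : i != j by apply: contraNneq jF => <-.
have [s [sB js is_ tB]] := connected_swap mB rB cB ij; exists s => //.
have := weight_swap (e_ F) js is_.
rewrite !weight_incid !mxE iF (negPf jF) subr0 -natrD => /eqP.
rewrite eqr_nat => /eqP E; apply: leq_trans (rankf_ge F tB).
by rewrite E addn1.
Qed.

Lemma Mw_eq_const w : Mw B w = B -> forall i j, w$i = w$j.
Proof.
move=> E; apply: const_weight => s t; rewrite -{1 2}E => /MwP[sB sm] /MwP[tB tm].
by apply/le_anti; rewrite sm // tm.
Qed.

Lemma const_ones w : (forall i j, w$i = w$j) -> exists c, w = c *: one_.
Proof.
move=> wc; case: (pickP 'I_n) => [i _|E].
  by exists (w$i); apply/rowP => j; rewrite !mxE mulr1.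
by exists 0; apply/rowP => j; have := E j.
Qed.

(** The hypothesis says that the functionals constant on the face of [F] lie in the plane spanned by
    [e_ F] and [one_]. The class of [e_ F] is then the open half-plane [0 < a], whose closure is the
    ray. *)
Lemma fan_cone_incid F i j : i \in F -> j \notin F ->
  (forall u, (forall s t, s \in Mw B (e_ F) -> t \in Mw B (e_ F) ->
                weight u s = weight u t) ->
     exists a t, u = a *: e_ F + t *: one_) ->
  fan_cone B (e_ F) = ray_of F.
Proof.
move=> iF jF spanF.
have classE w : Mw B w = Mw B (e_ F) -> exists a t, 0 < a /\ w = a *: e_ F + t *: one_.
  move=> wM; have [|a [t E]] := spanF w.
    move=> s t; rewrite -wM => /MwP[sB sm] /MwP[tB tm].
    by apply/le_anti; rewrite sm // tm.
  exists a, t; split=> //.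
  (* If [a <= 0], a basis that is not tight on [F] would be maximal for [w]; this forces the
     sign. *)
  have [s sB sF] := exists_slack iF jF.
  have [k kM] := exists_Mw mB (e_ F).
  have [kB kF] := (Mw_incidP R mB rB F k).1 kM.
  have sM : s \notin Mw B w.
    by rewrite wM; apply/negP => /(Mw_incidP R mB rB)[_ sF']; rewrite sF' ltnn in sF.
  rewrite ltNge; apply: contra sM => a0; apply/MwP; split=> // k' k'B.
  rewrite -wM in kM; have [_ /(_ k' k'B) km] := MwP _ _ _ kM.
  apply: le_trans km _; rewrite E !weightD !weightZ !weight_ones (rB sB) (rB kB).
  by rewrite lerD2r ler_wnM2l // !weight_incid ler_nat kF ltnW.
apply/seteqP; split=> w.
  (* The coefficients [w$i - w$j] and [w$j] are read off from coordinates; the resulting equations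
     and the weak sign condition are closed, so they pass to the closure. *)
  move=> wF; have cond k : w$k = (w$i - w$j) * (e_ F)$k + w$j.
    pose f (v : 'rV[R]_n) := v$k - ((v$i - v$j) * (e_ F)$k + v$j).
    have fc v : {for v, continuous (fun v : 'rV[R]_n =>
        v$k - ((v$i - v$j) * (e_ F)$k + v$j))}.
      apply: continuousB; first exact: coord_continuous.
      apply: continuousD; last exact: coord_continuous.
      apply: continuousM; last exact: cst_continuous.
      by apply: continuousB; exact: coord_continuous.
    have cl : closed [set v | f v = 0].
      apply: (@preimage_closed _ _ f [set a | a = 0]); last exact: closed_eq.
      by move=> v _; exact: fc.
    apply/eqP; rewrite -subr_eq0; apply/eqP; apply: cl; apply: closureS wF => v /=.
    move=> /classE[a [t [_ ->]]]; rewrite /f !mxE iF (negPf jF) /=; ring.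
  exists (w$i - w$j), (w$j); split; last first.
    by apply/rowP => k; rewrite (cond k) !mxE mulr1.
  have cl : closed [set v : 'rV[R]_n | 0 <= v$i - v$j].
    apply: (@preimage_closed _ _ (fun v : 'rV[R]_n => v$i - v$j) [set a | 0 <= a]).
      by move=> v _; apply: continuousB; exact: coord_continuous.
    exact: closed_ge.
  apply: cl; apply: closureS wF => v /= /classE[a [t [a0 ->]]].
  rewrite !mxE iF (negPf jF) /=; lra.
case=> a [t [a0 ->]] A /nbhs_ballP[e /= e0 eA].
exists ((a + e / 2) *: e_ F + t *: one_); split.
  by apply: Mw_affine; rewrite ltr_wpDl // divr_gt0.
apply: eA; split=> // o k; rewrite (ord1 o) /ball /= !mxE.
have -> : a * (k \in F)%:R + t * 1 - ((a + e / 2) * (k \in F)%:R + t * 1) =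
  - (e / 2 * (k \in F)%:R) by ring.
rewrite normrN; case: (k \in F); rewrite ?mulr1 ?mulr0 ?normr0 //.
rewrite ger0_norm; lra.
Qed.

Lemma rank_diffmx_matroid s0 : s0 \in B -> \rank (diffmx R B s0) = n.-1.
Proof.
move=> s0B; have := rank_ker_diffmx R B s0.
have [n0|n0] := posnP n; first by lia.
have -> : \rank (kermx (diffmx R B s0)^T) = 1%N; last by lia.
have -> : 1%N = \rank one_.
  rewrite rank_rV; suff -> : one_ != 0 by [].
  apply/eqP => /(congr1 (fun v : 'rV_n => v$(Ordinal n0))); rewrite !mxE.
  by apply/eqP; rewrite oner_eq0.
apply/eqmx_rank/andP; split; last first.
  by apply/ker_diffmxP => // s sB; rewrite !weight_ones (rB sB) (rB s0B).
apply/rV_subP => u /(ker_diffmxP _ s0B) uc.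
have [|c ->] := @const_ones u; last exact: scalemx_sub.
by apply: const_weight => s t sB tB; rewrite (uc s) // (uc t).
Qed.

(** The slack on [F] is an average of the nonnegative slacks of the bases, so it vanishes only if
    every basis with a nonzero coefficient is tight. *)
Lemma face_ofE F : face_of B F = polytope (Mw B (e_ F)) :> set 'rV[R]_n.
Proof.
apply/seteqP; split=> x.
  case=> -[l [l0 l1 xE]] xF; exists l.
  have lz s : s \in B -> s \notin Mw B (e_ F) -> l s = 0.
    have Fz : \sum_(s in B) l s * ((rankf B F)%:R - #|F :&: s|%:R) = 0.
      under eq_bigr do rewrite mulrBr; rewrite sumrB -mulr_suml l1 mul1r.
      apply/eqP; rewrite subr_eq0 -xF xE -/(weight _ F) -dot_incidr dotC dot_sumr.
      by apply/eqP; apply: eq_bigr => k _; rewrite dotZr dot_incidr weight_incid.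
    move=> sB sM; have /eqP : l s * ((rankf B F)%:R - #|F :&: s|%:R) = 0.
      apply: (psumr_eq0P _ Fz) => // k kB.
      by rewrite mulr_ge0 // subr_ge0 ler_nat rankf_ge.
    rewrite mulf_eq0 subr_eq0 => /orP[/eqP//|]; rewrite eqr_nat => /eqP E; case/negP: sM.
    exact/(Mw_incidP R mB rB).
  have subB s : s \in Mw B (e_ F) -> s \in B by case/MwP.
  split=> //.
    rewrite -l1 [RHS](bigID (mem (Mw B (e_ F)))) /= [X in _ + X]big1 ?addr0.
      by apply: eq_bigl => s; case: (boolP (s \in Mw B _)) => [/subB->|]; rewrite ?andbF.
    by move=> s /andP[sB sM]; apply: lz.
  rewrite xE [LHS](bigID (mem (Mw B (e_ F)))) /= [X in _ + X]big1 ?addr0.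
    by apply: eq_bigl => s; case: (boolP (s \in Mw B _)) => [/subB->|]; rewrite ?andbF.
  by move=> s /andP[sB sM]; rewrite lz ?scale0r.
case=> l [l0 l1 xE]; have subB s : s \in Mw B (e_ F) -> s \in B by case/MwP.
split.
  exists (fun s => if s \in Mw B (e_ F) then l s else 0); split.
  - by move=> s; case: ifP.
  - rewrite -l1 -big_mkcondr; apply: eq_bigl => s /=.
    by case: (boolP (s \in Mw B _)) => [/subB->|]; rewrite ?andbF.
  - rewrite xE [RHS](bigID (mem (Mw B (e_ F)))) /= [X in _ + X]big1 ?addr0.
      apply: eq_big => [s|s ->//].
      by case: (boolP (s \in Mw B _)) => [/subB->|]; rewrite ?andbF.
    by move=> s /andP[_ /negPf->]; rewrite scale0r.
rewrite -/(weight _ F) -dot_incidr dotC xE dot_sumr.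
rewrite (eq_bigr (fun s => l s * (rankf B F)%:R)).
  by rewrite -mulr_suml l1 mul1r.
move=> s sM; rewrite dotZr dot_incidr weight_incid.
by have [_ ->] := (Mw_incidP R mB rB F s).1 sM.
Qed.

Lemma loopless_flat F : loopless (Mw B (e_ F)) -> flat B F.
Proof.
move=> ll i iF; have [s sM is_] := ll i.
have [sB <-] := (Mw_incidP R mB rB F s).1 sM.
apply: leq_trans (rankf_ge _ sB); rewrite finset.setIUl.
have -> : [set i]%SET :&: s = [set i]%SET by apply/finset.setIidPl; rewrite finset.sub1set.
by rewrite cardsU1 inE (negPf iF).
Qed.

(** An [i] in [F] extends to a tight basis. For [i] outside [F], a basis tight on [i |: F] contains
    [i], because the rank increases, and is then tight on [F]. *)
Lemma flat_loopless F : loopless B -> flat B F -> loopless (Mw B (e_ F)).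
Proof.
move=> ll fF i; have [s sB is_] := ll i; have [iF|iF] := boolP (i \in F).
  have [||t [tB it tF]] := @extend_tight _ _ _ mB rB [set i]%SET F s sB.
  - by rewrite finset.sub1set.
  - by rewrite finset.sub1set.
  - exists t; last by rewrite -finset.sub1set.
    exact/(Mw_incidP R mB rB).
have [t tB tF] := rankf_attained mB (i |: F).
have := fF i iF; rewrite -tF finset.setIUl => lt.
have it : i \in t.
  apply: contraT => it; move: lt.
  have -> : [set i]%SET :&: t = finset.set0.
    by apply/setP => k; rewrite !inE; case: eqVneq => // ->; rewrite (negPf it).
  by rewrite finset.set0U ltnNge rankf_ge.
exists t => //; apply/(Mw_incidP R mB rB); split=> //.
apply/eqP; rewrite eqn_leq rankf_ge //= -ltnS; apply: leq_trans lt _.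
have -> : [set i]%SET :&: t = [set i]%SET by apply/finset.setIidPl; rewrite finset.sub1set.
by rewrite cardsU1 inE (negPf iF).
Qed.

(** A cone of dimension 2 is normal to a face of dimension [n - 2], one below that of the polytope;
    looplessness of this face corresponds to flatness of the set cutting it out. *)
Lemma cone_rayP (G : set 'rV[R]_n) :
  (exists w, loopless (Mw B w) /\ G = fan_cone B w) /\ has_affdim G 2 <->
  exists F, flacet R B F /\ G = ray_of F.
Proof.
split=> [[[w [ll GE]] dG]|[F [[fF [d [dP dF]]] ->]]].
  have [k [l kl]] : exists k l, w$l < w$k.
    apply: contrapT => nlt.
    have wc k l : w$k = w$l.
      apply/eqP; rewrite eq_le !leNgt; apply/andP; split; apply/negP => lt.
        by apply: nlt; exists k, l.
      by apply: nlt; exists l, k.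
    have [c wE] := const_ones wc.
    case: dG => -[p [pG fp]] _; suff : (2 <= 1)%N by [].
    apply: leq_trans (rank_leq_row one_); apply: aff_indep_leq_rank fp => k.
    have sp o : (p o <= one_)%MS.
      have := pG o; rewrite GE => /(fan_cone_sub); rewrite wE Mw_const => Bs.
      have [|b ->] := @const_ones (p o); last exact: scalemx_sub.
      apply: Mw_eq_const; apply/eqP; rewrite finset.eqEsubset Bs andbT; exact: Mw_subset.
    by rewrite addmx_sub // eqmx_opp.
  (* For this proper superlevel set, [w + e_ F], [w + one_] and [w + w] all stay in the class of
     [w]; dimension 2 then forces [w] into the span of [e_ F] and [one_]. *)
  pose F := [set i | w$k <= w$i]%SET.
  have kF : k \in F by rewrite inE.
  have lF : l \notin F by rewrite inE -ltNge.
  have up i j : i \in F -> j \notin F -> w$j < w$i.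
    by rewrite !inE -ltNge => ? ?; exact: lt_le_trans (_ : _ < w$k) _.
  have Gin u : Mw B u = Mw B w -> G u by rewrite GE => ?; apply: fan_cone_refl.
  have [||||a [t wE]] := @affdim2_dependent R n G F k l w w kF lF dG.
  - exact: Gin.
  - by apply: Gin; apply: MwD; apply: Mw_upper.
  - by apply: Gin; rewrite -[X in X + _]scale1r -[one_]scale1r Mw_affine.
  - by apply: Gin; apply: MwD.
  have a0 : 0 < a by move: kl; rewrite wE !mxE kF (negPf lF) /=; lra.
  have MwF : Mw B w = Mw B (e_ F) by rewrite wE Mw_affine.
  (* A small multiple of a functional constant on the face can be added to [e_ F] without leaving
     the class, so the same dimension argument applies to it. *)
  have spanF u : (forall s t, s \in Mw B (e_ F) -> t \in Mw B (e_ F) ->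
                weight u s = weight u t) -> exists a t, u = a *: e_ F + t *: one_.
    move=> /Mw_perturb[b b0 bM].
    have [||||a' [t' uE]] := @affdim2_dependent R n G F k l (e_ F) (b *: u) kF lF dG.
    - exact: Gin.
    - by apply: Gin; rewrite MwD.
    - by apply: Gin; rewrite -[X in X + _]scale1r -[one_]scale1r Mw_affine.
    - by apply: Gin; rewrite bM.
    exists (b^-1 * a'), (b^-1 * t'); rewrite -!scalerA -scalerDr -uE.
    by rewrite scalerA mulVf ?scale1r // gt_eqF.
  exists F; split; last by rewrite GE (fan_cone_eq MwF) (fan_cone_incid kF lF).
  split; first by apply: loopless_flat; rewrite -MwF.
  have [s0 s0M] := exists_Mw mB (e_ F); have [s0B _] := MwP _ _ _ s0M.
  have kerE : \rank (kermx (diffmx R (Mw B (e_ F)) s0)^T) = 2.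
    rewrite -[RHS](eqP (spanmx_free R kF lF)); apply/eqmx_rank/andP; split.
      apply/rV_subP => u /(ker_diffmxP _ s0M) uc; apply/spanmxP/spanF => s t' sM tM.
      by rewrite (uc s) // (uc t').
    rewrite /spanmx col_mx_sub; apply/andP; split; apply/ker_diffmxP => // s sM.
      have [_ sF] := (Mw_incidP R mB rB F s).1 sM.
      have [_ s0F] := (Mw_incidP R mB rB F s0).1 s0M.
      by rewrite !weight_incid sF s0F.
    by have [sB _] := MwP _ _ _ sM; rewrite !weight_ones (rB sB) (rB s0B).
  have rkE := rank_ker_diffmx R (Mw B (e_ F)) s0; rewrite kerE in rkE.
  exists (n - 2)%N; split.
    apply/(has_affdim_polytope R _ s0B); rewrite rank_diffmx_matroid //; lia.
  rewrite face_ofE; apply/(has_affdim_polytope R _ s0M); lia.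
have [s0 s0M] := exists_Mw mB (e_ F); have [s0B _] := MwP _ _ _ s0M.
move: dP dF; rewrite face_ofE.
move=> /(has_affdim_polytope R _ s0B); rewrite rank_diffmx_matroid // => nd.
move=> /(has_affdim_polytope R _ s0M) dF.
have [i [j [iF jF]]] : exists i j, i \in F /\ j \notin F.
  apply: contrapT => nF; have : Mw B (e_ F) = B.
    have [|c ->] := @const_ones (e_ F); last exact: Mw_const.
    move=> i j; rewrite !mxE; have [iF|iF] := boolP (i \in F);
      have [jF|jF] := boolP (j \in F) => //.
      by case: nF; exists i, j.
    by case: nF; exists j, i.
  by move=> E; move: dF; rewrite E rank_diffmx_matroid ?nd //; lia.
have ij : i != j by apply: contraNneq jF => <-.
have rkE := rank_ker_diffmx R (Mw B (e_ F)) s0.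
have spS : (spanmx R F <= kermx (diffmx R (Mw B (e_ F)) s0)^T)%MS.
  rewrite /spanmx col_mx_sub; apply/andP; split; apply/ker_diffmxP => // s sM.
    have [_ sF] := (Mw_incidP R mB rB F s).1 sM.
    have [_ s0F] := (Mw_incidP R mB rB F s0).1 s0M.
    by rewrite !weight_incid sF s0F.
  by have [sB _] := MwP _ _ _ sM; rewrite !weight_ones (rB sB) (rB s0B).
(* The kernel has dimension [n - d = 2] and contains the plane [spanmx R F], so the two agree. *)
have spE : (kermx (diffmx R (Mw B (e_ F)) s0)^T <= spanmx R F)%MS.
  rewrite -(geq_leqif (mxrank_leqif_sup spS)) (eqP (spanmx_free R iF jF)); lia.
have GE : fan_cone B (e_ F) = ray_of F.
  apply: (fan_cone_incid iF jF) => u uc; apply/spanmxP.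
  by apply: submx_trans spE; apply/ker_diffmxP => // s sM; apply: uc.
split; last exact: (has_affdim_ray _ iF jF).
exists (e_ F); split=> //; apply: flat_loopless => // k.
have [/eqP ki|ki] := boolP (k == i).
  by rewrite ki; have [s []] := connected_coloopless cB ij; exists s.
by have [s []] := connected_coloopless cB ki; exists s.
Qed.

End Rays.

(** * Relative interiors, and the boundary of the polytope off that of the simplex *)

Section RelativeBoundary.
Variables (R : realType) (n : nat).
Implicit Types (F s : {set 'I_n}) (u w x y z q : 'rV[R]_n) (S : set 'rV[R]_n).
Local Notation "w $ i" := (w ord0 i) (at level 1, i at level 9).
Local Notation e_ := (incid R).
Local Notation one_ := (ones R n).

Lemma finite_pos_lb (I : finType) (P : pred I) (f : I -> R) :
  (forall i, P i -> 0 < f i) -> exists2 e, 0 < e & forall i, P i -> e <= f i.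
Proof.
move=> f0; case: (pickP P) => [i0 Pi0|nP]; last by exists 1 => // i; rewrite nP.
by case: (arg_minP f Pi0) => i Pi imin; exists (f i); [exact: f0|].
Qed.

Lemma affhull_sum S c z : (forall x, S x -> \sum_i x$i = c) -> affhull S z ->
  \sum_i z$i = c.
Proof.
move=> Sc [k [p [l [pS l1 ->]]]]; rewrite -dot_onesl dot_sumr -[c]mul1r -l1 mulr_suml.
by apply: eq_bigr => i _; rewrite dotZr dot_onesl Sc.
Qed.

(** The point past [x] is an affine combination of [x] and [q], and [C] exceeds every coordinate of
    [x - q] in absolute value, so a step of [e / C] stays in the ball. Below, boundary points are
    recognised by a [q] that forbids any such step. *)
Lemma relint_extend S x q : relint S x -> S q ->
  exists2 a, 0 < a & S (x + a *: (x - q)).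
Proof.
case=> Sx [e e0 eS] Sq; pose C := \sum_i `|(x - q)$i| + 1.
have C0 : 0 < C by rewrite ltr_wpDl // sumr_ge0.
exists (e / C); first by rewrite divr_gt0.
apply: eS.
  exists 2, (fun i : 'I_2 => if i == ord0 then x else q).
  exists (fun i : 'I_2 => if i == ord0 then 1 + e / C else - (e / C)).
  rewrite !big_ord_recl !big_ord0 /=; split=> [i||].
  - by case: ifP.
  - ring.
  - by apply/rowP => i; rewrite !mxE; ring.
split=> // o k; rewrite (ord1 o) /ball /= !mxE.
rewrite opprD addrA subrr sub0r normrN normrM gtr0_norm ?divr_gt0 //.
rewrite -mulrA gtr_pMr // mulrC ltr_pdivrMr // mul1r.
rewrite /C (bigD1 k) //= !mxE -addrA ltrDl ltr_wpDl // sumr_ge0 //.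
Qed.

Lemma not_relbd S x : S x -> ~ relbd S x -> relint S x.
Proof.
move=> Sx nr; apply: contrapT => nri; apply: nr; split=> //.
exact: subset_closure.
Qed.

Variables (r : nat) (B : {set {set 'I_n}}).
Hypotheses (mB : is_matroid B) (rB : has_rank B r).

(** Explicit form, for a connected matroid, of the space on the polytope side of the homotopy
    equivalence; [i] and [j] record that [F] is nonempty and proper. *)
Definition inner_boundary x : Prop :=
  [/\ polytope B x, forall i, 0 < x$i &
      exists F i j, [/\ i \in F, j \notin F & weight x F = (rankf B F)%:R]].

Lemma polytope_simplex x : polytope B x -> simplex r x.
Proof.
by move=> Px; split=> [i|]; [exact: polytope_ge0 Px | exact: polytope_sum Px].
Qed.

Lemma improper_tight z F : \sum_i z$i = r%:R ->
  (forall i j, i \in F -> j \notin F -> False) -> weight z F <= (rankf B F)%:R.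
Proof.
move=> zr iF; have [->|[i iF']] := set_0Vmem F.
  by rewrite /weight big_set0.
have -> : F = [set: 'I_n]%SET.
  by apply/setP => j; rewrite inE; apply: contraT => jF; case: (iF i j).
rewrite weight_setT zr ler_nat; have [s sB] := exists_basis mB.
by have := rankf_ge [set: 'I_n]%SET sB; rewrite finset.setTI (rB sB).
Qed.

(** Finitely many strict inequalities leave a common margin [e]; moving each coordinate by less than
    [e / n.+1] respects it, and the empty and full sets are settled by the coordinate sum on the
    affine hull. *)
Lemma relint_of_slack x : polytope B x ->
  (forall F i j, i \in F -> j \notin F -> weight x F < (rankf B F)%:R) ->
  relint (polytope B) x.
Proof.
move=> Px lt; split=> //.
pose proper F := [exists i in F, exists j, j \notin F].
have [e e0 ele] : exists2 e, 0 < e &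
    forall F, proper F -> e <= (rankf B F)%:R - weight x F.
  apply: finite_pos_lb => F /existsP[i /andP[iF /existsP[j jF]]].
  by rewrite subr_gt0 (lt _ i j).
pose a := e / (n.+1)%:R; have a0 : 0 < a by rewrite divr_gt0 // ltr0n.
exists a => // z /(affhull_sum (polytope_sum rB)) zr xz.
apply/(polytopeP mB rB); split=> // F.
have [pF|nF] := boolP (proper F); last first.
  apply: improper_tight => // i j iF jF; case/negP: nF.
  by apply/existsP; exists i; rewrite iF; apply/existsP; exists j.
have := ele F pF; rewrite lerBrDr; apply: le_trans.
rewrite -lerBlDr -weightN -weightD.
have : \sum_(i in F) (z - x)$i <= \sum_(i in F) a.
  apply: ler_sum => i _; have [_ /(_ ord0 i)] := xz; rewrite /ball /= !mxE.
  by rewrite distrC => /ltW; apply: le_trans; exact: ler_norm.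
rewrite -/(weight _ F) sumr_const => /le_trans; apply.
rewrite /a -[_ *+ _]mulr_natr mulrAC ler_pdivrMr ?ltr0n // ler_pM2l // ler_nat.
by rewrite (leq_trans (max_card _)) // card_ord.
Qed.

Hypothesis cB : connected_matroid B.

Lemma relbd_diffE :
  relbd (polytope B) `\` relbd (simplex r) = inner_boundary.
Proof.
apply/seteqP; split=> x.
  case=> -[clx nri] nsx.
  have Px : polytope B x by have /closure_id -> := @polytope_closed R n B.
  have [F [i [j [iF jF tF]]]] : exists F i j,
      [/\ i \in F, j \notin F & weight x F = (rankf B F)%:R].
    apply: contrapT => nt; apply: nri; apply: relint_of_slack => // F i j iF jF.
    rewrite lt_neqAle polytope_le // andbT; apply/eqP => E.
    by apply: nt; exists F, i, j.
  split=> //; last by exists F, i, j.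
  move=> k; rewrite lt_neqAle (polytope_ge0 _ Px) andbT eq_sym; apply/eqP => xk.
  have ij : i != j by apply: contraNneq jF => <-.
  have [s sB ks] : exists2 s, s \in B & k \in s.
    have [ki|ki] := eqVneq k i.
      by rewrite ki; have [s []] := connected_coloopless cB ij; exists s.
    by have [s []] := connected_coloopless cB ki; exists s.
  have r0 : (0 < r)%N by rewrite -(rB sB); apply/card_gt0P; exists k.
  (* If [x$k = 0], moving past [x] away from this vertex of the simplex makes coordinate [k]
     negative, so [x] would not be relatively interior. *)
  have Sq : simplex r (r%:R *: e_ [set k]%SET).
    split=> [l|]; first by rewrite !mxE mulr_ge0.
    rewrite -dot_onesl dotZr dot_incidr weight_ones cards1 mulr1 //.
  have [a a0 [/(_ k)]] := relint_extend (not_relbd (polytope_simplex Px) nsx) Sq.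
  rewrite !mxE xk !inE eqxx mulr1 add0r sub0r mulrN oppr_ge0 => le _.
  by move: le; rewrite leNgt mulr_gt0 // ltr0n.
case=> Px x0 [F [i [j [iF jF tF]]]].
split; first split; first exact: subset_closure.
  (* Moving past [x] away from a vertex that is not tight on [F] violates the inequality of [F]. *)
  have [s sB sF] := exists_slack R mB rB cB iF jF.
  move=> /relint_extend/(_ (polytope_incid R sB))[a a0 /(polytope_le F)].
  rewrite weightD weightZ weightD weightN tF weight_incid gerDl leNgt.
  by rewrite mulr_gt0 // subr_gt0 ltr_nat finset.setIC.
case=> _; apply; split; first exact: polytope_simplex.
have [e e0 ele] := @finite_pos_lb _ xpredT (fun i => x$i) (fun i _ => x0 i).
exists e => // z /(@affhull_sum _ r%:R) zr xz; split; last first.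
  by apply: zr => y [].
move=> k; have [_ /(_ ord0 k)] := xz; rewrite /ball /= => /(le_lt_trans (ler_norm _)).
have := ele k isT; lra.
Qed.

End RelativeBoundary.

(** * Projection to the unit sphere modulo constants *)

Section Normalise.
Variables (R : realType) (n : nat).
Implicit Types (u w : 'rV[R]_n).
Local Notation "w $ i" := (w ord0 i) (at level 1, i at level 9).
Local Notation one_ := (ones R n).

Lemma sumr_const_ord (c : R) : \sum_(i < n) c = n%:R * c.
Proof. by rewrite sumr_const card_ord mulr_natl. Qed.

Definition center u : 'rV[R]_n := u - (n%:R^-1 * \sum_i u$i) *: one_.

Definition radius u : R := Num.sqrt (\sum_i (center u)$i ^+ 2).

(** On constant vectors [radius] is 0 and its inverse is 0 by convention, so the result lies on the
    sphere only under [nonconst]. *)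
Definition normalise u : 'rV[R]_n := (radius u)^-1 *: center u.

Definition nonconst u : Prop := exists i j, u$i != u$j.

Lemma nonconst_dim u : nonconst u -> (0 < n)%N.
Proof. by case=> i _; exact: leq_trans (ltn_ord i). Qed.

Lemma center_sum u : nonconst u -> \sum_i (center u)$i = 0.
Proof.
move=> /nonconst_dim n0; have -> : \sum_i (center u)$i =
    \sum_i u$i - (n%:R^-1 * \sum_i u$i) * n%:R.
  rewrite [_ * n%:R]mulrC -sumr_const_ord -sumrB.
  by apply: eq_bigr => i _; rewrite !mxE mulr1.
by rewrite mulrAC mulVf ?mul1r ?subrr // pnatr_eq0 -lt0n.
Qed.

Lemma radius_gt0 u : nonconst u -> 0 < radius u.
Proof.
case=> i [j ij]; rewrite /radius sqrtr_gt0 lt_def sumr_ge0 ?andbT; last first.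
  by move=> k _; exact: sqr_ge0.
apply: contra ij => /eqP/psumr_eq0P z.
have cz k : (center u)$k = 0.
  by apply/eqP; rewrite -sqrf_eq0; apply/eqP/z => // l _; exact: sqr_ge0.
have := cz i; have := cz j; rewrite !mxE => Ej Ei; apply/eqP; lra.
Qed.

Lemma normalise_sphere u : nonconst u -> sphere (normalise u).
Proof.
move=> nu; have r0 := radius_gt0 nu; split.
  under eq_bigr do rewrite mxE; by rewrite -mulr_sumr center_sum // mulr0.
under eq_bigr do rewrite mxE exprMn; rewrite -mulr_sumr exprVn /radius sqr_sqrtr.
  rewrite mulVf //; apply: contraTneq r0 => E.
  by rewrite /radius E sqrtr0 ltxx.
by rewrite sumr_ge0 // => k _; exact: sqr_ge0.
Qed.

Lemma sphere_nonconst w : sphere w -> nonconst w.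
Proof.
case=> s0 s1; apply: contrapT => nw.
have wc i j : w$i = w$j by apply/eqP/negPn/negP => ij; apply: nw; exists i, j.
have [n0|n0] := posnP n.
  move: s1; rewrite big1 => [/eqP|i _]; first by rewrite eq_sym oner_eq0.
  by have := ltn_ord i; rewrite [X in (_ < X)%N]n0.
have /eqP : \sum_(i < n) w$(Ordinal n0) = 0 by rewrite -[RHS]s0; apply: eq_bigr.
rewrite sumr_const_ord mulf_eq0 pnatr_eq0 (gtn_eqF n0) /=.
move=> /eqP w0; move: s1; rewrite big1 => [/eqP|i _].
  by rewrite eq_sym oner_eq0.
by rewrite (wc i (Ordinal n0)) w0 expr0n.
Qed.

Lemma normalise_id w : sphere w -> normalise w = w.
Proof.
case=> s0 s1; have cw : center w = w by rewrite /center s0 mulr0 scale0r subr0.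
by rewrite /normalise /radius cw s1 sqrtr1 invr1 scale1r.
Qed.

Lemma normaliseE u : exists t, normalise u = (radius u)^-1 *: u + t *: one_.
Proof. by eexists; rewrite /normalise scalerDr -scaleNr scalerA. Qed.

(** Centred entries still have absolute value at most [c]; the factor [n] replaces the sharper
    square root of [n]. *)
Lemma radius_le u c : 0 <= c -> (forall i, 0 <= u$i <= c) -> radius u <= n%:R * c.
Proof.
move=> c0 uc; have [n0|n0] := posnP n.
  rewrite /radius big1 ?sqrtr0 ?mulr_ge0 // => i _.
  by have := ltn_ord i; rewrite [X in (_ < X)%N]n0.
have n0R : 0 < n%:R :> R by rewrite ltr0n.
rewrite -[leRHS]ger0_norm ?mulr_ge0 // -sqrtr_sqr; apply: ler_wsqrtr.
have -> : (n%:R * c) ^+ 2 = n%:R * (n%:R * c ^+ 2) by ring.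
have m0 : 0 <= n%:R^-1 * \sum_i u$i.
  by rewrite mulr_ge0 // sumr_ge0 // => i _; case/andP: (uc i).
have mc : n%:R^-1 * \sum_i u$i <= c.
  rewrite mulrC ler_pdivrMr // [c * _]mulrC -sumr_const_ord.
  by apply: ler_sum => i _; case/andP: (uc i).
have : \sum_i (center u)$i ^+ 2 <= \sum_(i < n) c ^+ 2.
  apply: ler_sum => i _; rewrite !mxE mulr1; case/andP: (uc i) => u0 u1.
  set m := n%:R^-1 * _ in m0 mc *; nra.
rewrite sumr_const_ord => /le_trans; apply.
by rewrite ler_pM2l // ler_peMl ?sqr_ge0 // ler1n.
Qed.

Lemma normalise_continuous u : nonconst u -> {for u, continuous normalise}.
Proof.
move=> nu; have sc : continuous (fun v : 'rV[R]_n => \sum_i v$i).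
  by move=> v; apply: for_continuous_sum => i _; exact: coord_continuous.
have cc v : {for v, continuous (fun w => w - (n%:R^-1 * \sum_i w$i) *: one_)}.
  apply: continuousB; first exact: cvg_id.
  apply: continuousZr_tmp; apply: continuousM; last exact: sc.
  exact: cst_continuous.
have rc : continuous radius.
  move=> v; apply: (@continuous_comp _ _ _ (fun v => \sum_i (center v)$i ^+ 2) Num.sqrt);
    last exact: sqrt_continuous.
  apply: for_continuous_sum => i _.
  have c1 : {for v, continuous (fun v => (center v)$i)}.
    by apply: (@continuous_comp _ _ _ center (fun v => v$i)); [exact: cc | exact: coord_continuous].
  exact: continuousM.
apply: continuousZ; last exact: cc.
by apply: continuousV; [rewrite gt_eqF // radius_gt0 | exact: rc].
Qed.

End Normalise.

(** * Homotopy equivalence of the Bergman complex and the boundary part *)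

Section HomotopyEquivalence.
Variables (R : realType) (n r : nat) (B : {set {set 'I_n}}).
Hypotheses (mB : is_matroid B) (rB : has_rank B r) (cB : connected_matroid B).
Implicit Types (F s : {set 'I_n}) (u w x y : 'rV[R]_n).
Local Notation "w $ i" := (w ord0 i) (at level 1, i at level 9).
Local Notation e_ := (incid R).
Local Notation one_ := (ones R n).
Local Notation N := #|{: {set 'I_n}}|.

Lemma card_sets_gt0 : (0 < N)%N.
Proof. by apply/card_gt0P; exists finset.set0. Qed.

Lemma card_bases_gt0 : (0 < #|B|)%N.
Proof. by have [s sB] := exists_basis mB; apply/card_gt0P; exists s. Qed.

Lemma const_Mw w : ~ nonconst w -> Mw B w = B.
Proof.
move=> nw; have [|c ->] := @const_ones R n w; last exact: (Mw_const rB).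
by move=> i j; apply/eqP/negPn/negP => ij; apply: nw; exists i, j.
Qed.

Lemma Mw_nonconst w : Mw B w <> B -> nonconst w.
Proof. by move=> wB; apply: contrapT => /const_Mw/wB. Qed.

Lemma nonconst_Mw w : nonconst w -> Mw B w <> B.
Proof.
by case=> i [j ij] E; move/eqP: ij; apply; exact: (Mw_eq_const mB rB cB E).
Qed.

Lemma Mw_normalise u : nonconst u -> Mw B (normalise u) = Mw B u.
Proof.
move=> nu; have [t ->] := normaliseE u.
by apply: (Mw_affine mB rB); rewrite invr_gt0 radius_gt0.
Qed.

Lemma bergman_complexP w : bergman_complex B w <-> loopless (Mw B w) /\ sphere w.
Proof.
by rewrite /bergman_complex; split=> -[] /(bergman_fanP mB rB) ? ?.
Qed.

Lemma normalise_bergman u : nonconst u -> loopless (Mw B u) ->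
  bergman_complex B (normalise u).
Proof.
move=> nu lu; apply/bergman_complexP; rewrite Mw_normalise //.
by split=> //; exact: normalise_sphere.
Qed.

(** * From the Bergman complex to the boundary of the base polytope *)

(** Small enough that [n * n * delta <= 1], for the gap on the sphere, and [n * N * delta <= 1], for
    comparing [eps] with the radius; [N] counts the subsets of the ground set. *)
Definition delta : R := ((n * n * N).+1%:R)^-1.

Lemma delta_gt0 : 0 < delta.
Proof. by rewrite invr_gt0 ltr0n. Qed.

Lemma delta_le k : (k <= n * n * N)%N -> k%:R * delta <= 1.
Proof.
by move=> le; rewrite ler_pdivrMr ?ltr0n // mul1r ler_nat; exact: leq_trans le _.
Qed.

(** The product is nonzero exactly when the weight of [s] is less than [delta] below that of every
    basis, and it varies continuously with [w]. *)
Definition basis_coef w s : R :=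
  \prod_(t in B) Num.max 0 (delta - (weight w t - weight w s)).

Definition basis_mass w : R := \sum_(s in B) basis_coef w s.

Definition to_boundary w : 'rV[R]_n :=
  \sum_(s in B) (basis_coef w s / basis_mass w) *: e_ s.

Lemma max0_ge0 (a : R) : 0 <= Num.max 0 a.
Proof. by rewrite le_max lexx. Qed.

Lemma basis_coef_ge0 w s : 0 <= basis_coef w s.
Proof. by apply: prodr_ge0 => t _; exact: max0_ge0. Qed.

Lemma basis_coef_neq0 w s : basis_coef w s != 0 ->
  forall t, t \in B -> weight w t - weight w s < delta.
Proof.
move=> /prodf_neq0 c0 t tB; rewrite -subr_gt0 ltNge; apply: contra (c0 t tB) => le.
by rewrite (max_idPl le).
Qed.

Lemma basis_coef_max w s k : s \in Mw B w -> k \in B ->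
  basis_coef w k <= basis_coef w s.
Proof.
move=> /MwP[sB smax] kB; apply: ler_prod => t tB; rewrite max0_ge0 /=.
by rewrite ge_max max0_ge0 le_max lerD2l lerN2 lerD2l lerN2 smax // orbT.
Qed.

Lemma basis_coef_Mw_gt0 w s : s \in Mw B w -> 0 < basis_coef w s.
Proof.
move=> /MwP[sB smax]; apply: prodr_gt0 => t tB; rewrite lt_max subr_gt0.
by rewrite (le_lt_trans _ delta_gt0) ?orbT // subr_le0 smax.
Qed.

Lemma basis_mass_gt0 w : 0 < basis_mass w.
Proof.
have [s sM] := exists_Mw mB w; have [sB _] := MwP _ _ _ sM.
rewrite /basis_mass (bigD1 s) //= ltr_wpDr ?basis_coef_Mw_gt0 //.
by apply: sumr_ge0 => k _; exact: basis_coef_ge0.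
Qed.

Lemma coef_mass_ge0 w s : 0 <= basis_coef w s / basis_mass w.
Proof. by rewrite divr_ge0 ?basis_coef_ge0 // ltW // basis_mass_gt0. Qed.

Lemma coef_mass_sum w : \sum_(s in B) basis_coef w s / basis_mass w = 1.
Proof. by rewrite -mulr_suml divff // gt_eqF // basis_mass_gt0. Qed.

Lemma to_boundary_polytope w : polytope B (to_boundary w).
Proof.
exists (fun s => basis_coef w s / basis_mass w); split=> //.
- by move=> s; exact: coef_mass_ge0.
- exact: coef_mass_sum.
Qed.

Lemma to_boundary_slack w F :
  (rankf B F)%:R - weight (to_boundary w) F =
  \sum_(s in B) basis_coef w s / basis_mass w * ((rankf B F)%:R - #|F :&: s|%:R).
Proof.
under eq_bigr do rewrite mulrBr; rewrite sumrB -mulr_suml coef_mass_sum mul1r.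
rewrite weight_dot dot_sumr; congr (_ - _); apply: eq_bigr => s _.
by rewrite dotZr dot_incidr weight_incid.
Qed.

Lemma coef_mass_Mw_ge w s : s \in Mw B w ->
  #|B|%:R^-1 <= basis_coef w s / basis_mass w.
Proof.
move=> sM; rewrite ler_pdivlMr ?basis_mass_gt0 // mulrC ler_pdivrMr ?ltr0n ?card_bases_gt0 //.
rewrite mulr_natr -sumr_const; apply: ler_sum => k kB; exact: basis_coef_max.
Qed.

Lemma natr_slack_ge1 F s : s \in B -> #|F :&: s| != rankf B F ->
  1 <= (rankf B F)%:R - #|F :&: s|%:R :> R.
Proof.
move=> sB sF; have lt : (#|F :&: s| < rankf B F)%N by rewrite ltn_neqAle sF rankf_ge.
by rewrite lerBrDr nat1r ler_nat.
Qed.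

Lemma natr_slack_ge0 F s : s \in B -> 0 <= (rankf B F)%:R - #|F :&: s|%:R :> R.
Proof. by move=> sB; rewrite subr_ge0 ler_nat rankf_ge. Qed.

(** Slacks of bases are integers: a maximal basis that is not tight contributes at least 1, with
    coefficient at least [#|B|%:R^-1]. *)
Lemma to_boundary_near_tight w s F : s \in Mw B w ->
  (rankf B F)%:R - weight (to_boundary w) F < #|B|%:R^-1 ->
  #|F :&: s| = rankf B F.
Proof.
move=> sM; have [sB _] := MwP _ _ _ sM; rewrite to_boundary_slack => lt.
apply/eqP; apply: contraLR lt => sF; rewrite -leNgt (bigD1 s) //= ler_wpDr //.
  by rewrite sumr_ge0 // => k /andP[kB _]; rewrite mulr_ge0 ?coef_mass_ge0 ?natr_slack_ge0.
rewrite (le_trans (coef_mass_Mw_ge sM)) // ler_peMr ?coef_mass_ge0 //.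
exact: natr_slack_ge1.
Qed.

(* If every proper superlevel set had gap below [delta], then starting from the
   minimum the set of [i] with [w_i < min + k delta] would gain an element at
   each step, forcing all entries of [w] to be smaller than [1 / n]. *)
Lemma sphere_gap w : sphere w -> exists F i j,
  [/\ i \in F, j \notin F &
      forall k l, k \in F -> l \notin F -> w$l + delta <= w$k].
Proof.
move=> sw; have [i0 _] := sphere_nonconst sw; case: sw => s0 s1.
have d0 := delta_gt0.
case: (arg_minP (fun i => w$i) (isT : xpredT i0)) => m _ wm.
apply: contrapT => nF.
pose S k := [set i | w$i < w$m + k%:R * delta]%SET.
have Sk k : (0 < k)%N -> (k <= n)%N -> (k <= #|S k|)%N.
  elim: k => // k IHk _ kn; have [->|k0] := posnP k.
    by apply/card_gt0P; exists m; rewrite inE mul1r ltrDl.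
  have {}IHk := IHk k0 (ltnW kn).
  have sub : S k \subset S k.+1.
    apply/fintype.subsetP => i; rewrite !inE => /lt_trans; apply.
    by rewrite ltrD2l ltr_pM2r // ltr_nat.
  have mS : m \in S k by rewrite inE ltrDl mulr_gt0 // ltr0n.
  have [E|nE] := eqVneq (S k) [set: 'I_n]%SET.
    have := subset_leq_card sub; rewrite E cardsT card_ord => le.
    exact: leq_trans kn le.
  have [i iS] : exists i, i \notin S k.
    apply/existsP; rewrite -negb_forall; apply: contra nE => /forallP all.
    by apply/eqP/setP => i; rewrite all inE.
  apply: contrapT => /negP; rewrite -ltnNge ltnS => le.
  have SE : S k = S k.+1.
    by apply/eqP; rewrite eqEcard sub (leq_trans le).
  apply: nF; exists (~: S k)%SET, i, m; split; rewrite ?inE ?negbK //.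
    by move: iS; rewrite inE.
    by move: mS; rewrite inE.
  move=> p q; rewrite !finset.in_setC negbK {1}SE !inE -leNgt => pS qS.
  by rewrite (le_trans _ pS) // -natr1 mulrDl mul1r addrA lerD2r ltW.
have n0 : (0 < n)%N by exact: leq_trans (ltn_ord i0).

have ST : S n = [set: 'I_n]%SET.
  by apply/eqP; rewrite eqEcard finset.subsetT cardsT card_ord Sk.
have wM i : w$i < w$m + n%:R * delta.
  by have := finset.in_setT i; rewrite -ST inE.
have n0R : 0 < n%:R :> R by rewrite ltr0n.
(* As the entries sum to 0, their minimum is at most 0 and exceeds [- (n%:R * delta)]. So all
   entries are below [n%:R * delta] in absolute value, and their squares sum to less than 1. *)
have m0 : w$m <= 0.
  rewrite -(pmulr_rle0 _ n0R) -s0 -sumr_const_ord.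
  by apply: ler_sum => i _; exact: wm.
have mpos : 0 < w$m + n%:R * delta.
  rewrite -(pmulr_rgt0 _ n0R) -s0 -[ltRHS]sumr_const_ord.
  apply: ltr_sum => [|i _]; last exact: wM.
  by apply/hasP; exists i0; rewrite ?mem_index_enum.
have nd : n%:R * (n%:R * delta) <= 1.
  by rewrite mulrA -natrM delta_le // leq_pmulr // card_sets_gt0.
have : \sum_i w$i ^+ 2 < \sum_(i < n) (n%:R * delta) ^+ 2.
  apply: ltr_sum => [|i _]; first by apply/hasP; exists i0; rewrite ?mem_index_enum.
  have := wM i; have := wm i isT; set D := n%:R * delta in mpos * => wi1 wi2.
  have : 0 < (D - w$i) * (D + w$i) by apply: mulr_gt0; lra.
  by rewrite mulrDr !mulrBl; lra.
rewrite s1 sumr_const_ord ltNge => /negP; apply.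
have D0 : 0 <= n%:R * delta by rewrite mulr_ge0 // ltW.
have D1 : n%:R * delta <= 1.
  by apply: le_trans nd; rewrite ler_peMl // ler1n.
rewrite expr2 mulrA (le_trans (ler_wpM2l _ D1)) ?mulr1 //.
by rewrite mulr_ge0 // ltW.
Qed.

Lemma to_boundary_inner w : bergman_complex B w -> inner_boundary B (to_boundary w).
Proof.
move=> /bergman_complexP[ll sw]; split; first exact: to_boundary_polytope.
  move=> i; have [s sM is_] := ll i; have [sB _] := MwP _ _ _ sM.
  rewrite summxE (bigD1 s) //= ltr_wpDr //.
    by apply: sumr_ge0 => k _; rewrite !mxE mulr_ge0 // coef_mass_ge0.
  by rewrite !mxE is_ mulr1 divr_gt0 ?basis_mass_gt0 ?basis_coef_Mw_gt0.
have [F [i [j [iF jF gap]]]] := sphere_gap sw; exists F, i, j; split=> //.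
apply/esym/eqP; rewrite -subr_eq0 to_boundary_slack; apply/eqP.
apply: big1 => s sB; have [->|c0] := eqVneq (basis_coef w s) 0; first by rewrite !mul0r.
rewrite (gap_tight (w := w) mB rB sB) ?subrr ?mulr0 // => k l t kF lF tB.
have := basis_coef_neq0 c0 tB; have := gap k l kF lF; lra.
Qed.

Lemma max0_continuous (T : topologicalType) (f : T -> R) (p : T) :
  {for p, continuous f} -> {for p, continuous (fun z => Num.max 0 (f z))}.
Proof. by move=> fc; apply: (@continuous_max R T (fun=> 0) f) => //; exact: cst_continuous. Qed.

Lemma basis_coef_continuous s : continuous (basis_coef ^~ s).
Proof.
move=> w; apply: for_continuous_prod => t _; apply: max0_continuous.
apply: continuousB; first exact: cst_continuous.
by apply: continuousB; exact: weight_continuous.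
Qed.

Lemma to_boundary_continuous : continuous to_boundary.
Proof.
move=> w; apply: for_continuous_sum => s _; apply: continuousZr_tmp.
apply: continuousM; first exact: basis_coef_continuous.
apply: continuousV; first by rewrite gt_eqF // basis_mass_gt0.
by apply: for_continuous_sum => k _; exact: basis_coef_continuous.
Qed.

(** * From the boundary of the base polytope to the Bergman complex *)

(** A continuous substitute for a small multiple of the minimum: on the inner boundary the
    coordinates lie in []0, 1]], so their product is at most each of them, and the factor makes
    [N + #|B|] times [eps x] smaller still. *)
Definition eps x : R := ((N + #|B|).+1%:R)^-1 * \prod_i x$i.

(** On the inner boundary this is positive exactly when the slack of [F] at [x] is below [eps x],
    and equals [eps x] when [F] is tight at [x]. *)
Definition face_coef x F : R :=
  Num.max 0 (eps x - ((rankf B F)%:R - weight x F)).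

Definition to_normal x : 'rV[R]_n := \sum_F face_coef x F *: e_ F.

Lemma inner_coord_le1 x i : inner_boundary B x -> x$i <= 1.
Proof.
case=> Px _ _; have -> : x$i = dot (e_ [set i]%SET) x by rewrite -weight_dot /weight big_set1.
apply: polytope_dot_le Px _ => s _; rewrite weight_incid -[leRHS]/(1%:R) ler_nat.
by rewrite -(cards1 i) subset_leq_card // finset.subsetIl.
Qed.

Lemma inner_prod x i : inner_boundary B x -> 0 < \prod_j x$j <= x$i.
Proof.
move=> Yx; have [_ x0 _] := Yx; rewrite prodr_gt0 //= (bigD1 i) //=.
apply: ler_piMr; [exact: ltW | apply: prodr_ile1 => j _].
by rewrite ltW //= inner_coord_le1.
Qed.

Lemma inner_dim x : inner_boundary B x -> exists i : 'I_n, True.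
Proof. by case=> _ _ [_ [i _]]; exists i. Qed.

Lemma eps_gt0 x : inner_boundary B x -> 0 < eps x.
Proof. by case=> _ x0 _; rewrite mulr_gt0 ?invr_gt0 ?ltr0n // prodr_gt0. Qed.

Lemma eps_lt x i k : inner_boundary B x -> (k <= N + #|B|)%N -> k%:R * eps x < x$i.
Proof.
move=> Yx le; have /andP[p0 px] := inner_prod i Yx.
apply: lt_le_trans px; rewrite /eps mulrA gtr_pMl //.
by rewrite ltr_pdivrMr ?ltr0n // mul1r ltr_nat ltnS.
Qed.

Lemma eps_lt_card x : inner_boundary B x -> eps x < #|B|%:R^-1.
Proof.
move=> Yx; have [i _] := inner_dim Yx.
rewrite -[ltRHS]mul1r ltr_pdivlMr ?ltr0n ?card_bases_gt0 // mulrC.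
by apply: lt_le_trans (eps_lt i Yx (leq_addl _ _)) _; exact: inner_coord_le1.
Qed.

Lemma face_coef_ge0 x F : 0 <= face_coef x F.
Proof. exact: max0_ge0. Qed.

Lemma face_coef_le x F : inner_boundary B x -> face_coef x F <= eps x.
Proof.
move=> Yx; rewrite ge_max ltW ?eps_gt0 //= lerBlDr lerDl subr_ge0.
by case: Yx => Px _ _; exact: polytope_le.
Qed.

Lemma face_coef_neq0 x F : face_coef x F != 0 ->
  (rankf B F)%:R - weight x F < eps x.
Proof.
rewrite -subr_gt0 ltNge; apply: contra => le; rewrite /face_coef (max_idPl _) //.
Qed.

(* Every [i] lies in a basis tight for all sets which are nearly tight at [x]:
   the total slack of these sets is an average over the bases, so it would be
   at least [x_i] otherwise. *)
Lemma common_tight_basis x i : inner_boundary B x -> exists s,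
  [/\ s \in B, i \in s & forall F, face_coef x F != 0 -> #|F :&: s| = rankf B F].
Proof.
move=> Yx; have [[l [l0 l1 xE]] x0 _] := Yx; apply: contrapT => ns.
pose near F := face_coef x F != 0.
pose slack s : R := \sum_(F | near F) ((rankf B F)%:R - #|F :&: s|%:R).
have slack0 s : s \in B -> 0 <= slack s.
  by move=> sB; apply: sumr_ge0 => F _; exact: natr_slack_ge0.
have slack1 s : s \in B -> i \in s -> 1 <= slack s.
  move=> sB is_; have [F nF sF] : exists2 F, near F & #|F :&: s| != rankf B F.
    apply: contrapT => nF; apply: ns; exists s; split=> // F nearF.
    by apply/eqP/negPn/negP => sF; apply: nF; exists F.
  rewrite /slack (bigD1 F) //= ler_wpDr ?natr_slack_ge1 //.
  by apply: sumr_ge0 => G _; exact: natr_slack_ge0.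
have sumE : \sum_(F | near F) ((rankf B F)%:R - weight x F) = \sum_(s in B) l s * slack s.
  under [RHS]eq_bigr do rewrite mulr_sumr.
  rewrite [RHS]exchange_big; apply: eq_bigr => F _ /=.
  under [RHS]eq_bigr do rewrite mulrBr.
  rewrite sumrB -mulr_suml l1 mul1r weight_dot xE dot_sumr; congr (_ - _).
  by apply: eq_bigr => s _; rewrite dotZr dot_incidr weight_incid.
have : x$i <= \sum_(s in B) l s * slack s.
  rewrite xE summxE; apply: ler_sum => s sB; rewrite !mxE ler_wpM2l //.
  by case: (boolP (i \in s)) => is_; [exact: slack1 | exact: slack0].
rewrite -sumE leNgt => /negP; apply.
apply: le_lt_trans (eps_lt i Yx (leq_addr _ _)).
rewrite mulr_natl -sumr_const.
rewrite [leRHS](bigID near) /= ler_wpDr //.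
  by apply: sumr_ge0 => F _; rewrite ltW // eps_gt0.
by apply: ler_sum => F nF; rewrite ltW // face_coef_neq0.
Qed.

Lemma to_normal_weight x s :
  weight (to_normal x) s = \sum_F face_coef x F * #|F :&: s|%:R.
Proof. by rewrite weight_sum; apply: eq_bigr => F _; rewrite weightZ weight_incid. Qed.

(** The right-hand side bounds weights term by term, and a basis not tight on [F] falls short by an
    integer, at least 1, in the factor of [face_coef x F]. *)
Lemma to_normal_weight_gap x s F : s \in B -> #|F :&: s| != rankf B F ->
  weight (to_normal x) s + face_coef x F <= \sum_G face_coef x G * (rankf B G)%:R.
Proof.
move=> sB sF; rewrite to_normal_weight (bigD1 F) //= [leRHS](bigD1 F) //=.
rewrite addrAC lerD //; last first.
  by apply: ler_sum => G _; rewrite ler_wpM2l ?face_coef_ge0 // ler_nat rankf_ge.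
have := natr_slack_ge1 sB sF; have := face_coef_ge0 x F; nra.
Qed.

Lemma to_normal_Mw x s : s \in B ->
  (forall F, face_coef x F != 0 -> #|F :&: s| = rankf B F) ->
  s \in Mw B (to_normal x) /\
  weight (to_normal x) s = \sum_F face_coef x F * (rankf B F)%:R.
Proof.
move=> sB st; have E : weight (to_normal x) s = \sum_F face_coef x F * (rankf B F)%:R.
  rewrite to_normal_weight; apply: eq_bigr => F _.
  by have [->|/st->//] := eqVneq (face_coef x F) 0; rewrite !mul0r.
split=> //; apply/MwP; split=> // t tB; rewrite E to_normal_weight.
by apply: ler_sum => F _; rewrite ler_wpM2l ?face_coef_ge0 // ler_nat rankf_ge.
Qed.

Lemma to_normal_loopless x : inner_boundary B x -> loopless (Mw B (to_normal x)).
Proof.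
move=> Yx i; have [s [sB is_ st]] := common_tight_basis i Yx.
by exists s => //; case: (to_normal_Mw sB st).
Qed.

Lemma face_coef_tight x F : inner_boundary B x -> weight x F = (rankf B F)%:R ->
  face_coef x F = eps x.
Proof.
by move=> Yx tF; rewrite /face_coef tF subrr subr0; apply/max_idPr; rewrite ltW // eps_gt0.
Qed.

(** A constant vector would make all bases maximal, yet a basis not tight on the tight set [F] of
    [x] loses at least [eps x]. *)
Lemma to_normal_nonconst x : inner_boundary B x -> nonconst (to_normal x).
Proof.
move=> Yx; have [_ _ [F [i [j [iF jF tF]]]]] := Yx; apply: Mw_nonconst => E.
have [s sB sF] := exists_slack R mB rB cB iF jF.
have [t [tB _ tt]] := common_tight_basis i Yx.
have [tM tE] := to_normal_Mw tB tt.
have := to_normal_weight_gap x sB (_ : #|F :&: s| != rankf B F).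
rewrite ltn_eqF // => /(_ isT); rewrite (face_coef_tight Yx tF) -tE.
move: sB; rewrite -E => /MwP[_ /(_ t tB)]; have := eps_gt0 Yx; lra.
Qed.

Definition to_bergman x := normalise (to_normal x).

Lemma to_bergman_complex x : inner_boundary B x -> bergman_complex B (to_bergman x).
Proof.
move=> Yx; apply: normalise_bergman; first exact: to_normal_nonconst.
exact: to_normal_loopless.
Qed.

Lemma to_normal_continuous : continuous to_normal.
Proof.
move=> x; apply: for_continuous_sum => F _; apply: continuousZr_tmp.
apply: max0_continuous; apply: continuousB.
  apply: continuousM; first exact: cst_continuous.
  by apply: for_continuous_prod => i _; exact: coord_continuous.
by apply: continuousB; [exact: cst_continuous | exact: weight_continuous].
Qed.

(** Ensures that a weight loss of [eps x] is still at least [delta] after division by the radius. *)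
Lemma to_normal_radius x : inner_boundary B x -> delta * radius (to_normal x) <= eps x.
Proof.
move=> Yx; have e0 := ltW (eps_gt0 Yx).
have : radius (to_normal x) <= n%:R * (N%:R * eps x).
  apply: radius_le => [|i]; first by rewrite mulr_ge0.
  have -> : (to_normal x)$i = \sum_F face_coef x F * (i \in F)%:R.
    by rewrite summxE; apply: eq_bigr => F _; rewrite !mxE.
  apply/andP; split; first by apply: sumr_ge0 => F _; rewrite mulr_ge0 ?face_coef_ge0.
  rewrite mulr_natl -sumr_const; apply: ler_sum => F _.
  by case: (i \in F); rewrite ?mulr1 ?mulr0 // face_coef_le.
move=> /(ler_wpM2l (ltW delta_gt0))/le_trans; apply.
have -> : delta * (n%:R * (N%:R * eps x)) = (n * N)%:R * delta * eps x.
  by rewrite natrM; ring.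
have [i _] := inner_dim Yx; have n0 : (0 < n)%N := leq_ltn_trans (leq0n i) (ltn_ord i).
by rewrite ler_piMl // delta_le // leq_mul2r leq_pmulr ?orbT.
Qed.

(** Against a common tight basis, a basis not tight on [F] loses at least [eps x] before
    normalising, hence at least [delta] after it, and its coefficient vanishes. *)
Lemma to_bergman_tight x s F : inner_boundary B x ->
  weight x F = (rankf B F)%:R -> s \in B ->
  basis_coef (to_bergman x) s != 0 -> #|F :&: s| = rankf B F.
Proof.
move=> Yx tF sB c0; apply/eqP/negPn/negP => sF.
have [i _] := inner_dim Yx; have [t [tB _ tt]] := common_tight_basis i Yx.
have [tM tE] := to_normal_Mw tB tt.
have := to_normal_weight_gap x sB sF; rewrite (face_coef_tight Yx tF) -tE.
have := basis_coef_neq0 c0 tB; have r0 := radius_gt0 (to_normal_nonconst Yx).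
rewrite /to_bergman; have [a ->] := normaliseE (to_normal x).
rewrite !weightD !weightZ !weight_ones (rB sB) (rB tB) opprD addrACA subrr addr0.
rewrite -mulrBr mulrC ltr_pdivrMr // => lt.
have := to_normal_radius Yx; lra.
Qed.

(** * The two homotopies to the identity *)

Lemma bergman_homotopy :
  homotopic_to_id (bergman_complex B) (to_bergman \o to_boundary).
Proof.
pose L (p : R * 'rV[R]_n) := p.1 *: p.2 + (1 - p.1) *: to_normal (to_boundary p.2).
have key p : 0 <= p.1 <= 1 -> bergman_complex B p.2 ->
    nonconst (L p) /\ loopless (Mw B (L p)).
  case: p => a w /= /andP[a0 a1] Xw.
  have Yf := to_boundary_inner Xw.
  move/bergman_complexP: Xw => [ll sw].
  (* Sets with nonzero [face_coef] have slack below [eps], hence below [#|B|%:R^-1], so the maximal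
     bases of [w] are tight on all of them. *)
  have sub : Mw B w \subset Mw B (to_normal (to_boundary w)).
    apply/fintype.subsetP => s sM; have [sB _] := MwP _ _ _ sM.
    apply: (to_normal_Mw sB _).1 => F /face_coef_neq0 lt.
    apply: (to_boundary_near_tight sM); apply: lt_trans lt _; exact: eps_lt_card.
  have [a00|an0] := eqVneq a 0.
    rewrite /L /= a00 scale0r add0r subr0 scale1r.
    by split; [exact: to_normal_nonconst | exact: to_normal_loopless].
  (* For positive [a] the segment stays in the class of [w]; only at [a = 0] can the face be
     larger. *)
  have E : Mw B (L (a, w)) = Mw B w.
    have pa : 0 < a by rewrite lt_def an0.
    rewrite /L /= (MwD mB) (MwZ _ _ pa) //.
    have [->|b0] := eqVneq (1 - a) 0.
      by rewrite scale0r -(scale0r one_) (Mw_const rB) Mw_subset.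
    by rewrite MwZ // lt_def b0 subr_ge0.
  rewrite E; split=> //; apply: Mw_nonconst; rewrite E.
  exact/nonconst_Mw/sphere_nonconst.
exists (@normalise R n \o L); split=> [|p p01 Xp|w Xw|w Xw].
- apply: continuous_in_subspaceT => p; rewrite inE => -[p01 Xp].
  have [nL _] := key p p01 Xp.
  apply: (@continuous_comp _ _ _ L (@normalise R n)); last exact: normalise_continuous.
  apply: continuousD.
    by apply: continuousZ; [exact: cvg_fst | exact: cvg_snd].
  apply: continuousZ.
    by apply: continuousB; [exact: cst_continuous | exact: cvg_fst].
  apply: (@continuous_comp _ _ _ (fun p : R * 'rV[R]_n => to_boundary p.2) to_normal);
    last exact: to_normal_continuous.
  apply: (@continuous_comp _ _ _ (fun p : R * 'rV[R]_n => p.2) to_boundary);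
    last exact: to_boundary_continuous.
  exact: cvg_snd.
- by have [nL lL] := key p p01 Xp; exact: normalise_bergman.
- by rewrite /L /= scale0r add0r subr0 scale1r.
- rewrite /L /= scale1r subrr scale0r addr0 normalise_id //.
  by case/bergman_complexP: Xw.
Qed.

Lemma boundary_homotopy :
  homotopic_to_id (inner_boundary B) (to_boundary \o to_bergman).
Proof.
pose L (p : R * 'rV[R]_n) := (1 - p.1) *: to_boundary (to_bergman p.2) + p.1 *: p.2.
exists L; split=> [|[a x] /= a01 Yx|x Yx|x Yx].
- apply: continuous_in_subspaceT => p; rewrite inE => -[p01 Yp].
  change {for p, continuous L}.
  apply: continuousD; last by apply: continuousZ; [exact: cvg_fst | exact: cvg_snd].
  apply: continuousZ.
    by apply: continuousB; [exact: cst_continuous | exact: cvg_fst].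
  apply: (@continuous_comp _ _ _ (fun p : R * 'rV[R]_n => to_bergman p.2) to_boundary);
    last exact: to_boundary_continuous.
  apply: (@continuous_comp _ _ _ (fun p : R * 'rV[R]_n => to_normal p.2) (@normalise R n)).
    apply: (@continuous_comp _ _ _ (fun p : R * 'rV[R]_n => p.2) to_normal);
      last exact: to_normal_continuous.
    exact: cvg_snd.
  exact/normalise_continuous/to_normal_nonconst.
- have [Pf f0 _] := to_boundary_inner (to_bergman_complex Yx).
  have [Px x0 [F [i [j [iF jF tF]]]]] := Yx; rewrite /L /=; split.
  + exact: polytope_convex.
  + move=> k; rewrite !mxE; have := f0 k; have := x0 k; case/andP: a01 => a0 a1.
    set y := to_boundary _; move=> xk yk.
    have [->|an0] := eqVneq a 0; first by rewrite subr0 mul1r mul0r addr0.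
    rewrite ltr_wpDl // ?mulr_gt0 // ?lt_def ?an0 // mulr_ge0 ?subr_ge0 //.
    exact: ltW.
  (* Both ends of the segment are tight on the same [F], since every basis averaged in the image is
     tight on it. *)
  + exists F, i, j; split=> //; rewrite weightD !weightZ tF.
    have -> : weight (to_boundary (to_bergman x)) F = (rankf B F)%:R.
      apply/esym/eqP; rewrite -subr_eq0 to_boundary_slack; apply/eqP/big1 => s sB.
      have [->|c0] := eqVneq (basis_coef (to_bergman x) s) 0; first by rewrite !mul0r.
      by rewrite (to_bergman_tight Yx tF sB c0) subrr mulr0.
    ring.
- by rewrite /L /= subr0 scale1r scale0r addr0.
- by rewrite /L /= subrr scale0r scale1r add0r.
Qed.

Lemma bergman_homotopy_equiv :
  homotopy_equiv (@bergman_complex R n B) (inner_boundary B).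
Proof.
exists to_boundary, to_bergman; split.
- exact: to_boundary_inner.
- exact: to_bergman_complex.
- exact/continuous_subspaceT/to_boundary_continuous.
- apply: continuous_in_subspaceT => x; rewrite inE => Yx.
  apply: (@continuous_comp _ _ _ to_normal (@normalise R n)).
    exact: to_normal_continuous.
  exact/normalise_continuous/to_normal_nonconst.
- by split; [exact: bergman_homotopy | exact: boundary_homotopy].
Qed.

End HomotopyEquivalence.

Theorem theorem2p7 (R : realType) (n r : nat) (B : {set {set 'I_n}}) :
  is_matroid B -> has_rank B r ->
  @bergman_fan R n B =
    \bigcup_(w in [set w : 'rV[R]_n | loopless (Mw B w)]) fan_cone B w
  /\
  (connected_matroid B ->
     [set G : set 'rV[R]_n | (exists w, loopless (Mw B w) /\ G = fan_cone B w)
                             /\ has_affdim G 2]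
       = [set G | exists F, flacet R B F /\ G = @ray_of R n F]
     /\
     homotopy_equiv (@bergman_complex R n B)
       (relbd (@polytope R n B) `\` relbd (@simplex R n r))).
Proof.
move=> mB rB; split; first exact: (bergman_fan_cones R mB rB).
move=> cB; split.
  by apply/seteqP; split=> G /(cone_rayP mB rB cB).
by rewrite (relbd_diffE R mB rB cB); exact: (bergman_homotopy_equiv R mB rB cB).
Qed.
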